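(* Let $\mu$ be a measure on $\mathbb{R}^{m\times n}$. (A) If $\mu$ is contracting almost everywhere, then $\mu$ is extremal if and only if $\mu$ is inhomogeneously extremal. (B) If $\mu$ is strongly contracting almost everywhere, then $\mu$ is strongly extremal if and only if $\mu$ is inhomogeneously strongly extremal.
   Context: Notation: for $\mathbf q=(q_1,\dots,q_n)\in\mathbb{Z}^n$, $|\mathbf q|=\max_i|q_i|$ (supremum norm), $|\cdot|_2$ is the Euclidean norm. For $\mathbf y\in\mathbb{R}^m$, $\langle\mathbf y\rangle$ is the unique point of $[-1/2,1/2)^m$ congruent to $\mathbf y$ mod $\mathbb{Z}^m$, $\|\mathbf y\|=|\langle\mathbf y\rangle|$, $\prod\mathbf y=\prod_{j=1}^m|y_j|$, and $\prod_+(\mathbf q)=\prod_{i=1}^n\max\{1,|q_i|\}$. Vectors $\mathbf q,\boldsymbol\theta$ are columns. For $X\in\mathbb{R}^{m\times n}$, $\boldsymbol\theta\in\mathbb{R}^m$: $w(X,\boldsymbol\theta)$ is the supremum of $w\ge0$ such that for arbitrarily large $Q>1$ there is $\mathbf q\in\mathbb{Z}^n\setminus\{\mathbf 0\}$ with $\|X\mathbf q+\boldsymbol\theta\|^m<Q^{-w}$ and $|\mathbf q|^n\le Q$; $w^\times(X,\boldsymbol\theta)$ is the supremum of $w\ge0$ such that for arbitrarily large $Q>1$ there is $\mathbf q\in\mathbb{Z}^n\setminus\{\mathbf 0\}$ with $\prod\langle X\mathbf q+\boldsymbol\theta\rangle<Q^{-w}$ and $\prod_+(\mathbf q)\le Q$.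 Write $w(X)=w(X,\mathbf 0)$, $w^\times(X)=w^\times(X,\mathbf 0)$. A measure $\mu$ on $\mathbb{R}^{m\times n}$ is extremal if $w(X)=1$ for $\mu$-a.e. $X$; strongly extremal if $w^\times(X)=1$ for $\mu$-a.e. $X$; inhomogeneously extremal if for every $\boldsymbol\theta\in\mathbb{R}^m$, $w(X,\boldsymbol\theta)=1$ for $\mu$-a.e. $X$; inhomogeneously strongly extremal if for every $\boldsymbol\theta\in\mathbb{R}^m$, $w^\times(X,\boldsymbol\theta)=1$ for $\mu$-a.e. $X$. Planes: for $\mathbf a\in\mathbb{R}^n$ with $|\mathbf a|_2=1$ and $\mathbf b\in\mathbb{R}^m$, $\mathcal L_{\mathbf a,\mathbf b}=\{X: X\mathbf a+\mathbf b=\mathbf 0\}$, and for $\boldsymbol\varepsilon=(\varepsilon_1,\dots,\varepsilon_m)\in(0,\infty)^m$, $\mathcal L^{(\boldsymbol\varepsilon)}_{\mathbf a,\mathbf b}=\{X:|X_j\mathbf a+b_j|<\varepsilon_j\ \forall j\}$, $X_j$ the $j$-th row of $X$. For a ball $B$, $cB$ is the concentric ball with radius multiplied by $c$. The support $S$ of $\mu$ is the smallest closed set of full measure; $\mu$ is doubling if there is $\lambda>1$ with $\mu(2B)\le\lambda\mu(B)$ for all balls $B$ centred in $S$. A non-atomic, finite, doubling Borel measure $\mu$ on $\mathbb{R}^{m\times n}$ is strongly contracting if there are $C,\alpha,r_0>0$ such that for every plane $\mathcal L_{\mathbf a,\mathbf b}$, every $\boldsymbol\varepsilon\in(0,\infty)^m$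 with $\min_j\varepsilon_j<r_0$ and every $\delta\in(0,1)$: for every $X\in\mathcal L^{(\delta\boldsymbol\varepsilon)}_{\mathbf a,\mathbf b}\cap S$ there is an open ball $B$ centred at $X$ with $B\cap S\subset\mathcal L^{(\boldsymbol\varepsilon)}_{\mathbf a,\mathbf b}$ and $\mu(5B\cap\mathcal L^{(\delta\boldsymbol\varepsilon)}_{\mathbf a,\mathbf b})\le C\delta^\alpha\mu(5B)$. It is contracting if this holds whenever $\varepsilon_1=\dots=\varepsilon_m$. $\mu$ is (strongly) contracting almost everywhere if for $\mu$-a.e. $X_0$ there is a neighbourhood $U$ of $X_0$ such that the restriction $\mu|_U$ is (strongly) contracting. *)

(* Defs.v *)
From HB Require Import structures.
From mathcomp Require Import all_boot all_order all_algebra.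
From mathcomp Require Import all_classical all_reals all_analysis.

Set Implicit Arguments.
Unset Strict Implicit.
Unset Printing Implicit Defensive.

Import Order.TTheory GRing.Theory Num.Theory.
Import numFieldNormedType.Exports.

Local Open Scope classical_set_scope.
Local Open Scope ring_scope.

(* The library norm and balls on 'M[R]_(m, n) are those of the supremum norm:
   `|A| is the largest `|A i j|. *)

(** * Diophantine exponents *)

(* The representative of y modulo Z^m lying in [-1/2, 1/2)^m. *)
Definition centred_frac (R : realType) (m : nat) (y : 'cV[R]_m) : 'cV[R]_m :=
  \col_j (y j 0 - (Num.floor (y j 0 + 2^-1))%:~R).

Definition dist_int (R : realType) (m : nat) (y : 'cV[R]_m) : R :=
  `|centred_frac y|.

Definition prod_abs (R : realType) (m : nat) (y : 'cV[R]_m) : R :=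
  \prod_(j < m) `|y j 0|.

Definition prod_plus (R : realType) (n : nat) (q : 'cV[int]_n) : R :=
  \prod_(i < n) Num.max 1 `|(q i 0)%:~R|.

Definition intvec (R : realType) (n : nat) (q : 'cV[int]_n) : 'cV[R]_n :=
  map_mx intr q.

Definition exponent (R : realType) (m n : nat) (X : 'M[R]_(m, n))
    (theta : 'cV[R]_m) : \bar R :=
  ereal_sup [set w%:E | w in [set w : R | 0 <= w /\
    forall Q0 : R, exists Q : R, [/\ Q0 < Q, 1 < Q &
      exists q : 'cV[int]_n, [/\ q != 0,
        dist_int (X *m intvec R q + theta) ^+ m < Q `^ (- w) &
        `|intvec R q| ^+ n <= Q]]]].

Definition mult_exponent (R : realType) (m n : nat) (X : 'M[R]_(m, n))
    (theta : 'cV[R]_m) : \bar R :=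
  ereal_sup [set w%:E | w in [set w : R | 0 <= w /\
    forall Q0 : R, exists Q : R, [/\ Q0 < Q, 1 < Q &
      exists q : 'cV[int]_n, [/\ q != 0,
        prod_abs (centred_frac (X *m intvec R q + theta)) < Q `^ (- w) &
        prod_plus R q <= Q]]]].

(** * Measures on the Borel sigma-algebra of the space of matrices *)

Definition borel_mx (R : realType) (m n : nat) :=
  g_sigma_algebraType (@open 'M[R]_(m, n)).

Definition extremal (R : realType) (m n : nat)
    (mu : {measure set (borel_mx R m n) -> \bar R}) : Prop :=
  {ae mu, forall X, exponent (X : 'M[R]_(m, n)) 0 = 1%E}.

Definition strongly_extremal (R : realType) (m n : nat)
    (mu : {measure set (borel_mx R m n) -> \bar R}) : Prop :=
  {ae mu, forall X, mult_exponent (X : 'M[R]_(m, n)) 0 = 1%E}.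

Definition inhomogeneously_extremal (R : realType) (m n : nat)
    (mu : {measure set (borel_mx R m n) -> \bar R}) : Prop :=
  forall theta : 'cV[R]_m,
    {ae mu, forall X, exponent (X : 'M[R]_(m, n)) theta = 1%E}.

Definition inhomogeneously_strongly_extremal (R : realType) (m n : nat)
    (mu : {measure set (borel_mx R m n) -> \bar R}) : Prop :=
  forall theta : 'cV[R]_m,
    {ae mu, forall X, mult_exponent (X : 'M[R]_(m, n)) theta = 1%E}.

(** * Contracting measures *)

Definition norm2 (R : realType) (n : nat) (a : 'cV[R]_n) : R :=
  Num.sqrt (\sum_(i < n) a i 0 ^+ 2).

(* The eps-neighbourhood of the plane {X | X a + b = 0}. *)
Definition plane_nbhd (R : realType) (m n : nat) (a : 'cV[R]_n) (b : 'cV[R]_m)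
    (eps : 'cV[R]_m) : set 'M[R]_(m, n) :=
  [set X | forall j, `|(X *m a + b) j 0| < eps j 0].

(* The intersection of all closed sets of full measure; as the space of
   matrices is second countable, it is itself of full measure. *)
Definition msupport (R : realType) (m n : nat)
    (mu : {measure set (borel_mx R m n) -> \bar R}) : set 'M[R]_(m, n) :=
  \bigcap_(F in [set F : set 'M[R]_(m, n) | closed F /\ mu (~` F) = 0%E]) F.

Definition non_atomic (R : realType) (m n : nat)
    (mu : {measure set (borel_mx R m n) -> \bar R}) : Prop :=
  forall X : 'M[R]_(m, n), mu [set X] = 0%E.

Definition doubling (R : realType) (m n : nat)
    (mu : {measure set (borel_mx R m n) -> \bar R}) : Prop :=
  exists2 lambda : R, 1 < lambda &
    forall (X : 'M[R]_(m, n)) (r : R), msupport mu X -> 0 < r ->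
      (mu (ball X (2 * r)) <= lambda%:E * mu (ball X r))%E.

(* [E] singles out the widths of the neighbourhoods that are considered. *)
Definition contracting_for (R : realType) (m n : nat) (E : set 'cV[R]_m)
    (mu : {measure set (borel_mx R m n) -> \bar R}) : Prop :=
  [/\ non_atomic mu, (mu setT < +oo)%E, doubling mu &
  exists C alpha r0 : R, [/\ 0 < C, 0 < alpha, 0 < r0 &
    forall (a : 'cV[R]_n) (b eps : 'cV[R]_m) (delta : R),
      norm2 a = 1 ->
      E eps -> (forall j, 0 < eps j 0) -> (exists j, eps j 0 < r0) ->
      0 < delta < 1 ->
      forall X : 'M[R]_(m, n),
        plane_nbhd a b (delta *: eps) X -> msupport mu X ->
        exists r : R, [/\ 0 < r,
          ball X r `&` msupport mu `<=` plane_nbhd a b eps &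
          (mu (ball X (5 * r) `&` plane_nbhd a b (delta *: eps))
            <= (C * delta `^ alpha)%:E * mu (ball X (5 * r)))%E]]].

Definition strongly_contracting (R : realType) (m n : nat)
    (mu : {measure set (borel_mx R m n) -> \bar R}) : Prop :=
  contracting_for setT mu.

Definition contracting (R : realType) (m n : nat)
    (mu : {measure set (borel_mx R m n) -> \bar R}) : Prop :=
  contracting_for [set eps | forall i j, eps i 0 = eps j 0] mu.

(* Neighbourhoods are required to be Borel, so that the restriction of [mu] is
   a Borel measure; they need not be open. *)
Definition strongly_contracting_ae (R : realType) (m n : nat)
    (mu : {measure set (borel_mx R m n) -> \bar R}) : Prop :=
  {ae mu, forall X0, exists (U : set (borel_mx R m n)) (mU : measurable U),
    nbhs (X0 : 'M[R]_(m, n)) U /\ strongly_contracting (mrestr mu mU)}.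

Definition contracting_ae (R : realType) (m n : nat)
    (mu : {measure set (borel_mx R m n) -> \bar R}) : Prop :=
  {ae mu, forall X0, exists (U : set (borel_mx R m n)) (mU : measurable U),
    nbhs (X0 : 'M[R]_(m, n)) U /\ contracting (mrestr mu mU)}.

(* Main.v *)
Require Import Defs.
From mathcomp Require Import all_boot all_order all_algebra.
From mathcomp Require Import all_classical all_reals all_analysis.
From mathcomp Require Import ring lra zify.
Set Implicit Arguments.
Unset Strict Implicit.
Unset Printing Implicit Defensive.

Import Order.TTheory GRing.Theory Num.Theory.
Import numFieldNormedType.Exports.
Local Open Scope classical_set_scope.
Local Open Scope ring_scope.

                                   

(** One direction is the case [theta = 0]. For the other, fix [theta]; the lower and the upper bound
    for the inhomogeneous exponent have different causes.

    The lower bound is deterministic ([exponent_ge1]): w(X) <= 1 forces w(X, theta) >= 1. If X q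
    stays at distance at least 1/M from integer points for all nonzero |q| <= N, a pigeonhole
    argument ([inhom_approx]) shows that points X q + p, with q longer than N by a small power of N
    only, come close to every target. [exponent_le_mult] carries the bound over to the
    multiplicative exponent.

    The upper bound uses contraction. If q and q' both solve the inhomogeneous inequality at X, then
    q - q' solves a homogeneous one of almost the same quality. So on a set [G] without such
    homogeneous solutions, slightly thickened neighbourhoods of the planes X q + theta = p are
    pairwise disjoint, while contraction gives each thin neighbourhood only a proportion of order
    delta^alpha. Summing over the disjoint thick neighbourhoods ([disjoint_planes_cover]) with delta
    = 2^-k yields a convergent series, and Borel-Cantelli applies ([limsup_inhom_negligible]).
    Contraction speaks of whole balls rather than of their part in [G]; hence only points around
    which every ball has half of its mass in [G] are treated this way, and the maximal estimate
    [maximal_cover] bounds the other points by the mass outside [G], which can be made arbitrarily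
    small.

    An exponent above 1 is turned into conditions at dyadic scales by [approx_dyadic]. In the
    multiplicative case a solution has one of finitely many dyadic shapes ([prod_plus_pattern],
    [prod_pattern]), whose unequal side lengths call for strong contraction. *)

(** * Balls, Vitali covering and null sets in the space of matrices *)

Lemma mx_ballP (R : realType) (m n : nat) (X Y : 'M[R]_(m, n)) (r : R) :
  0 < r -> ball X r Y <-> (forall i j, `|X i j - Y i j| < r).
Proof. by move=> r0; split=> [[_ XY] i j|XY]; [exact: XY|split=> // i j; exact: XY]. Qed.

Lemma mx_norm_coord (R : realType) (m n : nat) (A : 'M[R]_(m, n)) i j :
  `|A i j| <= `|A|.
Proof. by rewrite -[`|A|]/(mx_norm A) mx_normrE; apply: (le_bigmax _ _ (i, j)). Qed.

Lemma mx_rat_dense (R : realType) (m n : nat) (X : 'M[R]_(m, n)) (r : R) :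
  0 < r -> exists q : 'M[rat]_(m, n), ball X r (map_mx ratr q).
Proof.
move=> r0.
have H (ij : 'I_m * 'I_n) : exists q : rat, `|X ij.1 ij.2 - ratr q| < r.
  have /rat_in_itvoo[q] : X ij.1 ij.2 - r < X ij.1 ij.2 + r by lra.
  rewrite in_itv /= => /andP[q1 q2]; exists q.
  by rewrite ltr_norml; apply/andP; split; lra.
have [f Hf] := choice H.
exists (\matrix_(i, j) f (i, j)); apply/(mx_ballP _ _ r0) => i j.
by rewrite !mxE; exact: (Hf (i, j)).
Qed.

Lemma countable_disjoint_balls (R : realType) (m n : nat)
    (D : set 'M[R]_(m, n)) (r : 'M[R]_(m, n) -> R) :
  (forall X, D X -> 0 < r X) -> trivIset D (fun X => ball X (r X)) ->
  countable D.
Proof.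
move=> r0 tD.
have H (X : 'M[R]_(m, n)) : exists q : 'M[rat]_(m, n),
    D X -> ball X (r X) (map_mx ratr q).
  have [DX|nDX] := pselect (D X); last by exists 0.
  by have [q Hq] := mx_rat_dense X (r0 _ DX); exists q.
have [f Hf] := choice H.
apply/countable_injP; exists (pickle \o f) => X Y; rewrite !inE => DX DY.
move=> /(pcan_inj pickleK) fXY; apply: tD => //.
by exists (map_mx ratr (f X)); split; [exact: Hf|rewrite fXY; exact: Hf].
Qed.

                                                                     
                                                                            
             
(** If some radius is at least [2 * R0], that one ball suffices. Otherwise the radii are bounded,
    and a maximal disjoint selection can be arranged so that every ball meets a selected one of at
    least half its radius; its centre is then within three of the selected radii. *)
Lemma vitali_centers (R : realType) (V : normedModType R) (A : set V)
    (r : V -> R) (R0 : R) :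
  (forall x, A x -> 0 < r x) -> A `<=` ball (0 : V) R0 ->
  exists D : set V, [/\ D `<=` A, trivIset D (fun x => ball x (r x)) &
    A `<=` \bigcup_(x in D) ball x (5 * r x)].
Proof.
move=> r0 AR0.
have AR x : A x -> `|x| < R0.
  by move=> /AR0; rewrite -ball_normE /= sub0r normrN.
have [[x [Ax xR0]]|small] := pselect (exists x, A x /\ 2 * R0 <= r x).
  exists [set x]; split => [_ ->//||]; first by move=> y z /= -> ->.
  move=> y Ay; exists x => //=; rewrite -ball_normE /=.
  have := AR _ Ay; have := AR _ Ax; have := ler_normB x y; have := r0 _ Ax; lra.
have rR0 x : A x -> r x <= 2 * R0.
  by move=> Ax; rewrite leNgt; apply/negP => /ltW xr; apply: small; exists x.
pose B x := ball x (r x).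
(* The last clause survives unions of chains and forbids selecting a small ball that blocks a much
   larger one. *)
pose P (D : set V) := [/\ D `<=` A, trivIset D B &
  forall x, A x -> (exists2 y, D y & B x `&` B y !=set0) ->
  exists2 y, D y & B x `&` B y !=set0 /\ r x <= 2 * r y].
have [|D [[DA tD PD] maxD]] := Zorn_bigcup (P := P).
  move=> F FP tF; split.
  - by move=> x [X FX Xx]; have [XA _ _] := FP _ FX; exact: XA.
  - move=> x y [X FX Xx] [Y FY Yy]; have [XY|YX] := tF _ _ FX FY.
      by have [_ + _] := FP _ FY; apply => //; exact: XY.
    by have [_ + _] := FP _ FX; apply => //; exact: YX.
  - move=> x Ax [y [X FX Xy] xy]; have [_ _] := FP _ FX.
    by move=> /(_ x Ax) []; [exists y|move=> z Xz H; exists z => //; exists X].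
have meets x : A x -> exists2 y, D y & B x `&` B y !=set0.
  move=> Ax; apply: contrapT => nx.
  (* Among the centres whose balls meet no selected ball, one with radius above half the supremum
     can be added without breaking [P], against maximality. *)
  pose E := [set x | A x /\ ~ exists2 y, D y & B x `&` B y !=set0].
  have hs : has_sup [set r x | x in E].
    split; first by exists (r x), x.
    by exists (2 * R0) => _ [z [Az _] <-]; exact: rR0.
  have s0 : 0 < sup [set r x | x in E].
    apply: (lt_le_trans (r0 _ Ax)); apply: ub_le_sup; first exact: hs.2.
    by exists x.
  have [|_ [x1 [Ax1 nx1] <-] x1s] := @sup_adherent _ _ (sup [set r x | x in E] / 2) _ hs.
    by rewrite divr_gt0.
  have nDx1 : ~ D x1.
    move=> Dx1; apply: nx1; exists x1 => //; exists x1; split; apply: ballxx; exact: r0.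
  apply: (maxD (D `|` [set x1])); first split.
  - by left.
  - by move=> H; apply: nDx1; apply: H; right.
  split.
  - by move=> y [/DA//|->].
  - move=> y z [Dy|->] [Dz|->] //.
    + exact: tD.
    + by rewrite setIC => yz; exfalso; apply: nx1; exists y.
    + by move=> yz; exfalso; apply: nx1; exists z.
  - move=> y Ay yD.
    have [yD'|nyD] := pselect (exists2 z, D z & B y `&` B z !=set0).
      by have [z Dz H] := PD _ Ay yD'; exists z => //; left.
    have [z [Dz|->] yz] := yD; first by exfalso; apply: nyD; exists z.
    exists x1; first by right.
    split=> //; have : r y <= sup [set r x | x in E].
      by apply: ub_le_sup; [exact: hs.2|exists y].
    by lra.
exists D; split=> // x Ax.
have [y Dy [[z [xz yz]] xy]] := PD _ Ax (meets _ Ax).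
exists y => //=; move: xz yz; rewrite /B -ball_normE /= => xz yz.
have ry := r0 _ (DA _ Dy).
have := ler_distD z y x; rewrite (distrC z x); lra.
Qed.

Lemma open_borel_mx (R : realType) (m n : nat) (A : set 'M[R]_(m, n)) :
  open A -> measurable (A : set (borel_mx R m n)).
Proof. by move=> oA; apply: sub_sigma_algebra. Qed.

Lemma closed_borel_mx (R : realType) (m n : nat) (A : set 'M[R]_(m, n)) :
  closed A -> measurable (A : set (borel_mx R m n)).
Proof.
by move=> cA; rewrite -(setCK A); apply: measurableC; apply: open_borel_mx; exact: closed_openC.
Qed.

Lemma ball_borel_mx (R : realType) (m n : nat) (X : 'M[R]_(m, n)) (r : R) :
  measurable (ball X r : set (borel_mx R m n)).
Proof.
have [r0|r0] := ltP 0 r; first by apply: open_borel_mx; exact: ball_open.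
rewrite (_ : ball X r = set0); first exact: measurable0.
by apply/seteqP; split=> // Y [] /=; rewrite ltNge r0.
Qed.

Lemma negligible_bigcup_countable (d : measure_display) (T : measurableType d)
    (R : realType) (mu : {measure set T -> \bar R}) (I : countType)
    (F : I -> set T) :
  (forall i, mu.-negligible (F i)) -> mu.-negligible (\bigcup_i F i).
Proof.
move=> nF; pose G k := if unpickle k is Some i then F i else set0.
apply: (@negligibleS _ _ _ _ (\bigcup_k G k)).
  by move=> x [i _ Fx]; exists (pickle i) => //; rewrite /G pickleK.
by apply: negligible_bigcup => k; rewrite /G; case: unpickle => // ; exact: negligible_set0.
Qed.

(** Lindelöf argument: each point lies in a ball with rational centre and radius 1/(k+1) whose trace
    on [A] is null, and there are countably many such balls. *)
Lemma negligible_local (R : realType) (m n : nat)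
    (mu : {measure set (borel_mx R m n) -> \bar R}) (A : set 'M[R]_(m, n)) :
  (forall X, A X -> exists2 U, nbhs X U & mu.-negligible (A `&` U)) ->
  mu.-negligible A.
Proof.
move=> Aloc.
pose B (i : 'M[rat]_(m, n) * nat) : set 'M[R]_(m, n) :=
  ball (map_mx ratr i.1 : 'M[R]_(m, n)) i.2.+1%:R^-1.
pose F i := [set X | A X /\ B i X /\ mu.-negligible (A `&` B i)].
apply: (@negligibleS _ (borel_mx R m n) _ mu (\bigcup_i F i)); last first.
  apply: negligible_bigcup_countable => i.
  have [N|N] := pselect (mu.-negligible (A `&` B i)).
    by apply: negligibleS N => X [AX [BX _]]; split.
  by apply: (negligibleS _ (negligible_set0 _)) => X [_ [_ /N]].
move=> X AX; have [U UX NU] := Aloc _ AX.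
have [e /= e0 eU] := (nbhs_ballP _ _).1 UX.
have [k] := ltr_add_invr (divr_gt0 e0 (ltr0Sn R 1)).
rewrite add0r => ke.
have k0 : (0 : R) < k.+1%:R^-1 by rewrite invr_gt0.
have [q Xq] := mx_rat_dense X k0.
exists (q, k) => //; split=> //; split; first exact: ball_sym.
apply: negligibleS NU => Y [AY BY]; split => //; apply: eU.
apply: (@le_ball _ _ _ (k.+1%:R^-1 + k.+1%:R^-1)).
  by move: ke; rewrite ltr_pdivlMr // mulr_natr mulr2n => /ltW.
exact: ball_triangle Xq BY.
Qed.

                                                

(** * Covering estimates for doubling measures *)

(** Subadditivity over the [F i], additivity over the disjoint [G i]. The index set is moved into
    the natural numbers by an injection [f]; [sel] is the reindexed family, empty off the image of
    [f]. *)
Lemma measure_bigcup_compare (d : measure_display) (T : measurableType d)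
    (R : realType) (mu : {measure set T -> \bar R}) (I : Type) (D : set I)
    (F G : I -> set T) (c : R) (E : set T) :
  countable D -> 0 <= c ->
  (forall i, D i -> measurable (F i)) -> (forall i, D i -> measurable (G i)) ->
  measurable E -> (forall i, D i -> G i `<=` E) -> trivIset D G ->
  (forall i, D i -> (mu (F i) <= c%:E * mu (G i))%E) ->
  measurable (\bigcup_(i in D) F i) /\
  (mu (\bigcup_(i in D) F i) <= c%:E * mu E)%E.
Proof.
move=> /countable_injP[f finj] c0 mF mG mE GE tG FG.
pose sel (H : I -> set T) k := \bigcup_(i in [set i | D i /\ f i = k]) H i.
have selE (H : I -> set T) i : D i -> sel H (f i) = H i.
  move=> Di; apply/seteqP; split=> [x [j [Dj fji] Hj]|x Hx]; last by exists i.
  by rewrite -(finj j i) // inE.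
have sel0 (H : I -> set T) k : ~ (exists2 i, D i & f i = k) -> sel H k = set0.
  by move=> nk; apply/seteqP; split=> // x [i [Di fi] _]; apply: nk; exists i.
have msel (H : I -> set T) k : (forall i, D i -> measurable (H i)) ->
    measurable (sel H k).
  move=> mH; have [[i Di <-]|/sel0->//] := pselect (exists2 i, D i & f i = k).
  by rewrite selE //; exact: mH.
have FE : \bigcup_(i in D) F i = \bigcup_k sel F k.
  apply/seteqP; split=> [x [i Di Fx]|x [k _ [i [Di _] Fx]]]; last by exists i.
  by exists (f i) => //; exists i.
have mU : measurable (\bigcup_k sel F k).
  by apply: bigcupT_measurable => k; exact: msel.
rewrite FE; split=> //.
apply: (le_trans (generalized_Boole_inequality mu (fun k => msel F k mF) mU)).
apply: (@le_trans _ _ (\sum_(0 <= k <oo) (c%:E * mu (sel G k)))%E).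
  apply: lee_nneseries => // k _.
  have [[i Di <-]|nk] := pselect (exists2 i, D i & f i = k).
    by rewrite !selE //; exact: FG.
  by rewrite !(sel0 _ _ nk) !measure0 mule0.
rewrite nneseriesZl//; apply: lee_wpmul2l; first by rewrite lee_fin.
rewrite -measure_semi_bigcup //.
- apply: le_measure; rewrite ?inE //.
    by apply: bigcupT_measurable => k; exact: msel.
  by move=> x [k _ [i [Di _] Gx]]; exact: (GE i).
- by move=> k; exact: msel.
- move=> k l _ _ [x [[i [Di <-] Gi] [j [Dj <-] Gj]]].
  by rewrite (tG i j) //; exists x.
- by apply: bigcupT_measurable => k; exact: msel.
Qed.

Lemma doubling_ball (R : realType) (m n : nat)
    (nu : {measure set (borel_mx R m n) -> \bar R}) (lambda : R)
    (X : 'M[R]_(m, n)) (r : R) : 0 <= lambda ->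
  (forall s, 0 < s -> (nu (ball X (2 * s)) <= lambda%:E * nu (ball X s))%E) ->
  0 < r -> (nu (ball X (5 * r)) <= (lambda ^+ 3)%:E * nu (ball X r))%E.
Proof.
move=> l0 dbl r0.
apply: (@le_trans _ _ (nu (ball X (2 * (2 * (2 * r)))))).
  apply: le_measure; rewrite ?inE; try exact: ball_borel_mx.
  by apply: le_ball; lra.
have step s (x : \bar R) : 0 < s -> (nu (ball X s) <= x -> nu (ball X (2 * s)) <= lambda%:E * x)%E.
  by move=> s0 sx; apply: (le_trans (dbl _ s0)); apply: lee_wpmul2l; rewrite ?lee_fin.
rewrite !exprS expr0 mulr1 !EFinM -!muleA.
by do 3 (apply: (step); first lra).
Qed.

Section covering_estimates.
Context (R : realType) (m n : nat)
  (nu : {measure set (borel_mx R m n) -> \bar R}) (lambda R0 : R).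
Hypothesis (lambda0 : 0 <= lambda).
Hypothesis (dbl : forall (X : 'M[R]_(m, n)) (r : R), msupport nu X -> 0 < r ->
  (nu (ball X (2 * r)) <= lambda%:E * nu (ball X r))%E).

Let S := msupport nu.

(** This is the weak-type bound for the maximal function of the indicator of [F], at height 1/2. As
    [A] may fail to be measurable, the bound is put on a measurable superset. *)
Lemma maximal_cover (A F : set 'M[R]_(m, n)) :
  measurable (F : set (borel_mx R m n)) ->
  A `<=` S `&` ball (0 : 'M[R]_(m, n)) R0 ->
  (forall X, A X -> exists2 r, 0 < r &
    (nu (ball X r) <= 2%:E * nu (ball X r `&` F))%E) ->
  exists E : set (borel_mx R m n), [/\ measurable E, A `<=` E &
    (nu E <= (lambda ^+ 3 * 2)%:E * nu F)%E].
Proof.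
move=> mF AS Ar.
have rE (X : 'M[R]_(m, n)) : exists t, A X -> 0 < t /\
    (nu (ball X t) <= 2%:E * nu (ball X t `&` F))%E.
  have [/Ar[t t0 H]|nA] := pselect (A X); first by exists t.
  by exists 0.
have [r Hr] := choice rE.
have [D [DA tD AD]] := @vitali_centers R _ A r R0 (fun X AX => (Hr X AX).1)
  (fun X AX => (AS X AX).2).
have [] := @measure_bigcup_compare _ (borel_mx R m n) R nu 'M[R]_(m, n) D
  (fun X => ball X (5 * r X)) (fun X => ball X (r X) `&` F) (lambda ^+ 3 * 2) F.
- by apply: countable_disjoint_balls tD => X /DA /Hr[].
- by rewrite mulr_ge0 // exprn_ge0.
- by move=> X _; exact: ball_borel_mx.
- by move=> X _; apply: measurableI => //; exact: ball_borel_mx.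
- by [].
- by move=> X _ Y [].
- move=> X Y DX DY [Z [[XZ _] [YZ _]]]; apply: tD => //; by exists Z.
- move=> X /DA AX; have [r0 H] := Hr _ AX.
  apply: (le_trans (doubling_ball lambda0 (fun s => dbl (AS _ AX).1) r0)).
  rewrite (EFinM (lambda ^+ 3)) -muleA; apply: lee_wpmul2l; first by rewrite lee_fin exprn_ge0.
  exact: H.
- by move=> mE nE; exists (\bigcup_(X in D) ball X (5 * r X)).
Qed.

(** For X in [A] and [L i], let B be the ball given by contraction. Then nu(5B ∩ L i) <= c nu(5B) <=
    c lambda^3 nu(B) <= 2 c lambda^3 nu(B ∩ G), and B ∩ G lies in [Lp i] because [G] lies in the
    support. Vitali selection makes the balls disjoint for fixed i, and the disjointness of the sets
    [Lp i] on [G] allows the summation over i. *)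
Lemma disjoint_planes_cover (I : Type) (D : set I)
    (L Lp : I -> set 'M[R]_(m, n)) (G A : set 'M[R]_(m, n)) (c : R) :
  0 <= c -> countable D ->
  (forall i, D i -> measurable (L i : set (borel_mx R m n))) ->
  (forall i, D i -> measurable (Lp i : set (borel_mx R m n))) ->
  measurable (G : set (borel_mx R m n)) -> G `<=` S ->
  trivIset D (fun i => Lp i `&` G) ->
  A `<=` S `&` ball (0 : 'M[R]_(m, n)) R0 ->
  (forall X r, A X -> 0 < r ->
    (nu (ball X r) <= 2%:E * nu (ball X r `&` G))%E) ->
  (forall i X, D i -> A X -> L i X -> exists r, [/\ 0 < r,
    ball X r `&` S `<=` Lp i &
    (nu (ball X (5 * r) `&` L i) <= c%:E * nu (ball X (5 * r)))%E]) ->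
  exists E : set (borel_mx R m n), [/\ measurable E,
    A `&` \bigcup_(i in D) L i `<=` E &
    (nu E <= (c * (lambda ^+ 3 * 2))%:E * nu setT)%E].
Proof.
move=> c0 cD mL mLp mG GS tD AS AG ctr.
have k0 : 0 <= lambda ^+ 3 * 2 by rewrite mulr_ge0 // exprn_ge0.
have cover1 i : exists E : set (borel_mx R m n), D i -> [/\ measurable E,
    A `&` L i `<=` E &
    (nu E <= (c * (lambda ^+ 3 * 2))%:E * nu (Lp i `&` G))%E].
  have [Di|nDi] := pselect (D i); last by exists set0.
  have rE (X : 'M[R]_(m, n)) : exists t, (A `&` L i) X -> [/\ 0 < t,
      ball X t `&` S `<=` Lp i &
      (nu (ball X (5 * t) `&` L i) <= c%:E * nu (ball X (5 * t)))%E].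
    have [[AX LX]|nA] := pselect ((A `&` L i) X); last by exists 0.
    by have [t Ht] := ctr _ _ Di AX LX; exists t.
  have [r Hr] := choice rE.
  have [|X [/AS[]]//|C [CA tC AC]] := @vitali_centers R _ (A `&` L i) r R0.
    by move=> X /Hr[].
  have [] := @measure_bigcup_compare _ (borel_mx R m n) R nu 'M[R]_(m, n) C
    (fun X => ball X (5 * r X) `&` L i) (fun X => ball X (r X) `&` G)
    (c * (lambda ^+ 3 * 2)) (Lp i `&` G).
  - by apply: countable_disjoint_balls tC => X /CA /Hr[].
  - by rewrite mulr_ge0.
  - by move=> X _; apply: measurableI; [exact: ball_borel_mx|exact: mL].
  - by move=> X _; apply: measurableI => //; exact: ball_borel_mx.
  - by apply: measurableI => //; exact: mLp.
  - move=> X /CA /Hr[_ H _] Y [XY GY]; split=> //; apply: H; split => //.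
    exact: GS.
  - by move=> X Y CX CY [Z [[XZ _] [YZ _]]]; apply: tC => //; exists Z.
  - move=> X CX; have [r0 _ H] := Hr _ (CA _ CX); apply: (le_trans H).
    have AX := (CA _ CX).1.
    rewrite (EFinM c) -muleA; apply: lee_wpmul2l; first by rewrite lee_fin.
    apply: (le_trans (doubling_ball lambda0 (fun s => dbl (AS _ AX).1) r0)).
    rewrite (EFinM (lambda ^+ 3)) -muleA; apply: lee_wpmul2l; first by rewrite lee_fin exprn_ge0.
    exact: AG.
  - move=> mE nE; exists (\bigcup_(X in C) (ball X (5 * r X) `&` L i)) => _.
    split=> //.
    by move=> X AX; have [Y CY XY] := AC _ AX; exists Y => //; split => //; exact: AX.2.
have [E HE] := choice cover1.
have [] := @measure_bigcup_compare _ (borel_mx R m n) R nu I D E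
  (fun i => Lp i `&` G) (c * (lambda ^+ 3 * 2)) setT cD.
- by rewrite mulr_ge0.
- by move=> i /HE[].
- by move=> i Di; apply: measurableI => //; exact: mLp.
- exact: measurableT.
- by [].
- by [].
- by move=> i /HE[].
- move=> mE nE; exists (\bigcup_(i in D) E i); split=> //.
  by move=> X [AX [i Di LX]]; exists i => //; have [_ + _] := HE _ Di; apply.
Qed.

End covering_estimates.

                            

(** * Integer vectors, neighbourhoods of planes, the support *)

Lemma norm2_coord (R : realType) (n : nat) (v : 'cV[R]_n) (i : 'I_n) :
  `|v i 0| <= norm2 v.
Proof.
rewrite -sqrtr_sqr /norm2 ler_sqrt; last by apply: sumr_ge0 => k _; exact: sqr_ge0.
by rewrite (bigD1 i) //= lerDl; apply: sumr_ge0 => k _; exact: sqr_ge0.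
Qed.

Lemma norm2_normalize (R : realType) (n : nat) (v : 'cV[R]_n) :
  0 < norm2 v -> norm2 ((norm2 v)^-1 *: v) = 1.
Proof.
move=> v0; rewrite {1}/norm2.
under eq_bigr do rewrite !mxE exprMn.
rewrite -mulr_sumr -[X in _ * X]sqr_sqrtr; last by apply: sumr_ge0 => k _; exact: sqr_ge0.
by rewrite -/(norm2 v) -exprMn mulVf ?gt_eqF// expr1n sqrtr1.
Qed.

Lemma intvec_coord_ge1 (R : realType) (n : nat) (q : 'cV[int]_n) :
  q != 0 -> exists i, 1 <= `|(q i 0)%:~R : R|.
Proof.
move=> q0; have [i qi] : exists i, q i 0 != 0.
  apply: contrapT => H; case/eqP: q0; apply/matrixP => i j; rewrite ord1 mxE.
  by apply/eqP; apply: contrapT => /negP qi; apply: H; exists i.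
by exists i; rewrite -intr_norm -[1]/(1%:~R) ler_int -gtz0_ge1 normr_gt0.
Qed.

Lemma norm2_intvec_ge1 (R : realType) (n : nat) (q : 'cV[int]_n) :
  q != 0 -> 1 <= norm2 (intvec R q).
Proof.
move=> q0; have [i qi] := intvec_coord_ge1 R q0.
by apply: le_trans (norm2_coord _ i); rewrite mxE.
Qed.

Lemma open_coord_lt (R : realType) (m n : nat) (J : pred 'I_m) (a : 'cV[R]_n)
    (b eps : 'cV[R]_m) :
  open [set X : 'M[R]_(m, n) | forall j, J j -> `|(X *m a + b) j 0| < eps j 0].
Proof.
rewrite openE => X HX.
apply: (@filter_forall _ _ (fun j (Y : 'M[R]_(m, n)) =>
  J j -> `|(Y *m a + b) j 0| < eps j 0) (nbhs X)) => j.
have [Jj|nJ] := boolP (J j); last by apply: filterE.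
have cont : (fun Y : 'M[R]_(m, n) => `|(Y *m a + b) j 0|) @ X --> `|(X *m a + b) j 0|.
  have E (Y : 'M[R]_(m, n)) : (Y *m a + b) j 0 = \sum_i Y j i * a i 0 + b j 0.
    by rewrite !mxE.
  rewrite E (_ : (fun _ => _) = (fun Y : 'M[R]_(m, n) =>
    `|\sum_i Y j i * a i 0 + b j 0|)); last by apply/funext => Y; rewrite E.
  have cs : (\sum_i Y j i * a i 0) @[Y --> X] --> \sum_i X j i * a i 0.
    elim: (index_enum _) => [|i l IH].
      by under eq_fun do rewrite big_nil; rewrite big_nil; exact: cvg_cst.
    under eq_fun do rewrite big_cons.
    rewrite big_cons; apply: (cvgD _ IH).
    by apply: cvgMl; exact: (@coord_continuous R m n j i X).
  exact: (cvg_norm (cvgD cs (cvg_cst (b j 0)))).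
have := HX _ Jj; rewrite -subr_gt0 => e0.
have /cvgrPdist_lt/(_ _ e0) := cont; apply: filterS => Y /= HY _.
have := ler_norm (`|(Y *m a + b) j 0| - `|(X *m a + b) j 0|).
rewrite distrC; lra.
Qed.

Lemma open_plane_nbhd (R : realType) (m n : nat) (a : 'cV[R]_n)
    (b eps : 'cV[R]_m) : open (plane_nbhd a b eps).
Proof.
rewrite (_ : plane_nbhd a b eps =
  [set X | forall j, xpredT j -> `|(X *m a + b) j 0| < eps j 0]).
  exact: open_coord_lt.
by apply/seteqP; split=> X H j => [_|]; exact: H.
Qed.

Section support.
Context (R : realType) (m n : nat)
  (nu : {measure set (borel_mx R m n) -> \bar R}).

Lemma closed_msupport : closed (msupport nu).
Proof. by apply: closed_bigI => F []. Qed.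

Lemma msupportC_negligible : nu.-negligible (~` msupport nu).
Proof.
apply: negligible_local => X nX.
have [F [cF nF] nFX] : exists2 F : set 'M[R]_(m, n),
    closed F /\ nu (~` F) = 0%E & ~ F X.
  apply: contrapT => H; apply: nX => F [cF nF]; apply: contrapT => nFX.
  by apply: H; exists F.
exists (~` F); first by apply: open_nbhs_nbhs; split=> //; exact: closed_openC.
exists (~` F); split => //.
by apply: open_borel_mx; exact: closed_openC.
Qed.

End support.

                                                 

                                                  
(** * Inhomogeneous solutions and their differences *)

(** Coordinates with [b j <= 1] are left free: their constraint would be too weak to survive the
    loss of two powers of [d] in [hom_near]. *)
Definition inhom_near (R : realType) (m n : nat) (P : set 'cV[int]_n)
    (theta : 'cV[R]_m) (b : 'I_m -> nat) (d : R) : set 'M[R]_(m, n) :=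
  [set X | exists q, [/\ P q, q != 0 & exists p : 'cV[int]_m,
    forall j, (1 < b j)%N ->
    `|(X *m intvec R q + theta) j 0 - (p j 0)%:~R| < d ^+ b j]].

(** One of the two lost powers comes from thickening the neighbourhoods by the factor 1/d, the other
    absorbs the factor 2 of the triangle inequality. *)
Definition hom_near (R : realType) (m n : nat) (P : set 'cV[int]_n)
    (b : 'I_m -> nat) (d : R) : set 'M[R]_(m, n) :=
  [set X | exists q q' (p : 'cV[int]_m), [/\ P q, P q', q != q' &
    forall j, (1 < b j)%N ->
    `|(X *m intvec R (q - q')) j 0 - (p j 0)%:~R| < d ^+ (b j - 2)]].

                                                                                
                                
(** Widths of the thick neighbourhoods: [t] will be the inverse Euclidean norm of q, and [w] will be
    so large that a free coordinate imposes nothing on the bounded region, even after scaling by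
    [d]. For constant [b > 1] all widths agree, as [contracting] demands. *)
Definition plane_widths (R : realType) (m : nat) (b : 'I_m -> nat) (d t w : R) :
    'cV[R]_m :=
  \col_j (if (1 < b j)%N then t * d ^+ (b j).-1 else w).

Lemma intvecB (R : realType) (n : nat) (q q' : 'cV[int]_n) :
  intvec R (q - q') = intvec R q - intvec R q'.
Proof. exact: map_mxB. Qed.

Lemma plane_nbhd_scale (R : realType) (m n : nat) (v : 'cV[R]_n)
    (w eps : 'cV[R]_m) (t : R) (X : 'M[R]_(m, n)) : 0 < t ->
  plane_nbhd (t^-1 *: v) (t^-1 *: w) eps X <->
  (forall j, `|(X *m v + w) j 0| < t * eps j 0).
Proof.
move=> t0.
have E j : `|(X *m (t^-1 *: v) + t^-1 *: w) j 0| = t^-1 * `|(X *m v + w) j 0|.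
  by rewrite -scalemxAr -scalerDr !mxE normrM gtr0_norm ?invr_gt0.
split=> H j; first by have := H j; rewrite E ltr_pdivrMl.
by rewrite E ltr_pdivrMl.
Qed.

Lemma mulmx_coord_lt (R : realType) (m n : nat) (X : 'M[R]_(m, n))
    (v : 'cV[R]_n) (theta : 'cV[R]_m) (R0 : R) (j : 'I_m) :
  0 < R0 -> ball (0 : 'M[R]_(m, n)) R0 X -> 1 <= norm2 v ->
  `|(X *m v + theta) j 0| < norm2 v * (n%:R * R0 + `|theta j 0| + 1).
Proof.
move=> R00 /(mx_ballP _ _ R00) XR v1.
have XR' i : `|X j i| <= R0.
  by have := XR j i; rewrite mxE sub0r normrN => /ltW.
rewrite !mxE; apply: (@le_lt_trans _ _ (\sum_(i < n) R0 * norm2 v + `|theta j 0|)).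
  apply: (le_trans (ler_normD _ _)); rewrite lerD2r.
  apply: (le_trans (ler_norm_sum _ _ _)); apply: ler_sum => i _.
  by rewrite normrM ler_pM // norm2_coord.
rewrite sumr_const card_ord -[R0 * norm2 v *+ n]mulr_natl.
have t0 : 0 <= `|theta j 0| by [].
have : `|theta j 0| <= norm2 v * `|theta j 0| by rewrite ler_peMl.
have -> : norm2 v * (n%:R * R0 + `|theta j 0| + 1) =
  n%:R * (R0 * norm2 v) + norm2 v * `|theta j 0| + norm2 v by ring.
lra.
Qed.

Lemma small_int_eq0 (R : realType) (z : int) : `|z%:~R : R| < 1 -> z = 0.
Proof.
rewrite -intr_norm -[1]/(1%:~R) ltr_int => z1.
by apply/eqP; rewrite -normr_eq0 -[_ == 0]negbK -normr_gt0 normr_id gtz0_ge1 -ltNge.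
Qed.

Lemma open_hom_near (R : realType) (m n : nat) (P : set 'cV[int]_n)
    (b : 'I_m -> nat) (d : R) : open (@hom_near R m n P b d).
Proof.
pose H (i : 'cV[int]_n * 'cV[int]_n * 'cV[int]_m) :=
  [set X : 'M[R]_(m, n) | forall j, (1 < b j)%N ->
    `|(X *m intvec R (i.1.1 - i.1.2) + - intvec R i.2) j 0|
      < (\col_j d ^+ (b j - 2)) j 0].
rewrite (_ : hom_near P b d = \bigcup_(i in [set i |
    [/\ P i.1.1, P i.1.2 & i.1.1 != i.1.2]]) H i).
  by apply: bigcup_open => i _; exact: (@open_coord_lt R m n (fun j => (1 < b j)%N)).
apply/seteqP; split=> [X [q [q' [p [Pq Pq' qq' HX]]]]|X [[[q q'] p] [/= Pq Pq' qq'] HX]].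
  by exists (q, q', p) => // j bj; have := HX j bj; rewrite /= !mxE.
by exists q, q', p; split => // j bj; have := HX j bj; rewrite /= !mxE.
Qed.

Section near_cover.
Context (R : realType) (m n : nat)
  (nu : {measure set (borel_mx R m n) -> \bar R}) (E : set 'cV[R]_m)
  (lambda C alpha r0 R0 : R) (b : 'I_m -> nat) (theta : 'cV[R]_m).
Hypothesis (lambda0 : 0 <= lambda).
Hypothesis (dbl : forall (X : 'M[R]_(m, n)) (r : R), msupport nu X -> 0 < r ->
  (nu (ball X (2 * r)) <= lambda%:E * nu (ball X r))%E).
Hypothesis (C0 : 0 < C) (R00 : 0 < R0).
Hypothesis (ctr : forall (a : 'cV[R]_n) (w eps : 'cV[R]_m) (delta : R),
  norm2 a = 1 -> E eps -> (forall j, 0 < eps j 0) ->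
  (exists j, eps j 0 < r0) -> 0 < delta < 1 ->
  forall X : 'M[R]_(m, n),
    plane_nbhd a w (delta *: eps) X -> msupport nu X ->
    exists r : R, [/\ 0 < r,
      ball X r `&` msupport nu `<=` plane_nbhd a w eps &
      (nu (ball X (5 * r) `&` plane_nbhd a w (delta *: eps))
        <= (C * delta `^ alpha)%:E * nu (ball X (5 * r)))%E]).
Hypothesis (b1 : exists j, (1 < b j)%N).
Hypothesis (Eb : forall d t w, E (plane_widths b d t w)).

Let R1 := n%:R * R0 + `|theta| + 1.

(** [disjoint_planes_cover] is applied to the planes X q + theta = p, with q normalised to Euclidean
    length 1 and with contraction factor delta = [d]. *)
Lemma inhom_near_cover (P : set 'cV[int]_n) (d : R) (G A : set 'M[R]_(m, n)) :
  0 < d <= 2^-1 -> d < r0 ->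
  measurable (G : set (borel_mx R m n)) -> G `<=` msupport nu ->
  G `&` hom_near P b d = set0 ->
  A `<=` msupport nu `&` ball (0 : 'M[R]_(m, n)) R0 ->
  (forall X r, A X -> 0 < r ->
    (nu (ball X r) <= 2%:E * nu (ball X r `&` G))%E) ->
  exists F : set (borel_mx R m n), [/\ measurable F,
    A `&` inhom_near P theta b d `<=` F &
    (nu F <= (C * d `^ alpha * (lambda ^+ 3 * 2))%:E * nu setT)%E].
Proof.
move=> /andP[d0 d2] dr0 mG GS Ghom AS AG.
pose N (i : 'cV[int]_n * 'cV[int]_m) := norm2 (intvec R i.1).
(* Free coordinates of p are fixed at 0; otherwise essentially the same neighbourhood would recur
   for many p and disjointness would fail. *)
pose D := [set i : 'cV[int]_n * 'cV[int]_m | [/\ P i.1, i.1 != 0 &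
  forall j, ~~ (1 < b j)%N -> i.2 j 0 = 0]].
pose eps i := plane_widths b d (N i)^-1 (R1 / d).
pose a i := (N i)^-1 *: intvec R i.1.
pose w i := (N i)^-1 *: (theta - intvec R i.2).
have N1 i : D i -> 1 <= N i by case=> _ q0 _; exact: norm2_intvec_ge1.
have N0 i : D i -> 0 < N i by move=> /N1; lra.
have R10 : 0 < R1.
  rewrite /R1 ltr_pwDr // addr_ge0 // mulr_ge0 //; exact: ltW.
have LpP i X : D i -> plane_nbhd (a i) (w i) (eps i) X -> forall j, (1 < b j)%N ->
    `|(X *m intvec R i.1 + theta) j 0 - (i.2 j 0)%:~R| < d ^+ (b j).-1.
  move=> Di /(plane_nbhd_scale _ _ _ _ (N0 _ Di)) H j bj; have := H j.
  rewrite {1}addrA /plane_widths !mxE bj mulrA mulfV ?mul1r ?gt_eqF ?N0 //.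
have := @disjoint_planes_cover R m n nu lambda R0 lambda0 dbl _ D
  (fun i => plane_nbhd (a i) (w i) (d *: eps i))
  (fun i => plane_nbhd (a i) (w i) (eps i)) G A (C * d `^ alpha).
move=> [].
- by rewrite mulr_ge0 ?powR_ge0 // ltW.
- exact: countableP.
- by move=> i _; apply: open_borel_mx; exact: open_plane_nbhd.
- by move=> i _; apply: open_borel_mx; exact: open_plane_nbhd.
- exact: mG.
- exact: GS.
-                                                                        
                                                                          
  (* At a common point of two thick neighbourhoods the difference is below 2 d^(b-1) <= d^(b-2). If
     q and q' differ, this contradicts the choice of [G]; if they agree, p - p' is an integer vector
     smaller than 1 in the constrained coordinates. *)
  move=> [q p] [q' p'] Di Di' [X [[LX GX] [LX' _]]].
  have H := LpP _ _ Di LX; have H' := LpP _ _ Di' LX'.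
  have key j : (1 < b j)%N -> `|(X *m intvec R (q - q')) j 0 -
      ((p - p') j 0)%:~R| < d ^+ (b j - 2).
    move=> bj; have := H' j bj; have := H j bj => /=.
    have -> : ((b j).-1 = (b j - 2).+1)%N by lia.
    rewrite intvecB mulmxBr exprS !mxE rmorphB /=.
    have e0 : 0 < d ^+ (b j - 2) by exact: exprn_gt0.
    have : d * d ^+ (b j - 2) <= 2^-1 * d ^+ (b j - 2) by rewrite ler_wpM2r // ltW.
    set x := \sum_(_ < n) _; set y := \sum_(_ < n) _.
    have := ler_normB (x + theta j 0 - (p j 0)%:~R) (y + theta j 0 - (p' j 0)%:~R).
    have -> : x + theta j 0 - (p j 0)%:~R - (y + theta j 0 - (p' j 0)%:~R) =
      x - y - ((p j 0)%:~R - (p' j 0)%:~R) by ring.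
    lra.
  have qq' : q = q'.
    apply/eqP; apply: contrapT => /negP qq'.
    have : (G `&` hom_near P b d) X.
      by split=> //; exists q, q', (p - p'); split=> //; [case: Di|case: Di'].
    by rewrite Ghom.
  subst q'; congr pair; apply/matrixP => j k; rewrite ord1.
  have [bj|bj] := boolP (1 < b j)%N; last first.
    by case: Di Di' => _ _ /(_ _ bj) /= -> [_ _ /(_ _ bj) /= ->].
  apply/eqP; rewrite -subr_eq0; apply/eqP/(@small_int_eq0 R).
  have := key _ bj; rewrite subrr /intvec raddf0 mulmx0 !mxE sub0r normrN => /lt_le_trans.
  by apply; apply: exprn_ile1; lra.
- exact: AS.
- exact: AG.
- move=> i X Di AX LX; apply: ctr => //.
  + by rewrite /a norm2_normalize // N0.
  + exact: Eb.
  + move=> j; rewrite /eps /plane_widths mxE; case: ifP => _; last by rewrite divr_gt0.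
    by rewrite mulr_gt0 ?invr_gt0 ?N0 // exprn_gt0.
  (* A constrained width is at most d^(b-1) <= d, since |q| >= 1 and b > 1. *)
  + have [j bj] := b1; exists j; rewrite /eps /plane_widths mxE bj.
    apply: le_lt_trans dr0; have -> : ((b j).-1 = (b j).-2.+1)%N by lia.
    rewrite exprS mulrCA ler_piMr //; first exact: ltW.
    apply: mulr_ile1.
    * by rewrite invr_ge0 ltW ?N0.
    * by apply: exprn_ge0; exact: ltW.
    * by rewrite invf_le1 ?N1 ?N0.
    * by apply: exprn_ile1; lra.
  + by apply/andP; split=> //; lra.
  + by case: (AS _ AX).
move=> F [mF FA nF]; exists F; split=> // X [AX [q [Pq q0 [p Hp]]]]; apply: FA.
split=> //; exists (q, \col_j (if (1 < b j)%N then p j 0 else 0)).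
  by split=> //= j /negbTE bj; rewrite mxE bj.
have Nq : 1 <= norm2 (intvec R q) by exact: norm2_intvec_ge1.
have Nq0 : 0 < norm2 (intvec R q) by lra.
apply/(plane_nbhd_scale _ _ _ _ Nq0) => j /=; rewrite addrA.
rewrite /eps /plane_widths; have := Hp j.
have := mulmx_coord_lt theta j R00 (AS _ AX).2 Nq.
rewrite !mxE; case: ifP => bj Hb.
  move=> /(_ isT) Hj; rewrite (_ : norm2 _ * _ = d ^+ b j) //.
  rewrite -[in RHS](prednK (ltnW bj)) exprS /N /=.
  by move: (norm2 (intvec R q)) (d ^+ (b j).-1) Nq0 => t u t0; field; rewrite gt_eqF.
move=> _; rewrite subr0 [d * (R1 / d)]mulrCA divff ?gt_eqF// mulr1.
apply: (lt_le_trans Hb); apply: ler_wpM2l; first exact: ltW.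
by rewrite /R1 lerD2r lerD2l; exact: mx_norm_coord.
Qed.

End near_cover.

(** * Borel-Cantelli for the limsup set *)

Lemma borel_cantelli_geometric (d : measure_display) (T : measurableType d)
    (R : realType) (mu : {measure set T -> \bar R}) (F : nat -> set T)
    (M t : R) : 0 <= t < 1 -> 0 <= M -> (forall k, measurable (F k)) ->
  (forall k, (mu (F k) <= (M * t ^+ k)%:E)%E) -> mu (lim_sup_set F) = 0%E.
Proof.
move=> /andP[t0 t1] M0 mF FM; apply: lim_sup_set_cvg0 => //.
apply: (@le_lt_trans _ _ (M / (1 - t))%:E); last by rewrite ltry.
apply: lime_le; first by apply: is_cvg_nneseries.
apply: nearW => k.
apply: (@le_trans _ _ (\sum_(0 <= i < k) (M * t ^+ i)%:E)%E); first exact: lee_sum.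
rewrite sumEFin lee_fin -mulr_sumr; apply: ler_wpM2l => //; rewrite big_mkord.
have := subrX1 t k; have := exprn_ge0 k t0 => tk E.
rewrite -[leRHS]mul1r ler_pdivlMr; last lra.
by move: E; set s := \sum_(_ < _) _ => E; lra.
Qed.

Lemma negligible_of_covers (d : measure_display) (T : measurableType d)
    (R : realType) (mu : {measure set T -> \bar R}) (A : set T)
    (H : nat -> set T) (u : nat -> \bar R) :
  (forall k, measurable (H k)) -> (forall k, A `<=` H k) ->
  (forall k, (mu (H k) <= u k)%E) -> u @ \oo --> 0%E -> mu.-negligible A.
Proof.
move=> mH AH Hu u0; exists (\bigcap_k H k); split.
- exact: bigcapT_measurable.
- apply/eqP; rewrite eq_le measure_ge0 andbT.
  apply: (cvge_to_ge u0); apply: nearW => k; apply: le_trans (Hu k).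
  by apply: le_measure; rewrite ?inE //; [exact: bigcapT_measurable|move=> x; exact].
- by move=> x Ax k _; exact: AH.
Qed.

Lemma measure_half_split (d : measure_display) (T : measurableType d)
    (R : realType) (mu : {measure set T -> \bar R}) (A G : set T) :
  (mu setT < +oo)%E -> measurable A -> measurable G ->
  ~ (mu A <= 2%:E * mu (A `&` G))%E -> (mu A <= 2%:E * mu (A `&` ~` G))%E.
Proof.
move=> fin mA mG.
have fA B : measurable B -> mu B \is a fin_num.
  move=> mB; rewrite ge0_fin_numE //; apply: le_lt_trans fin.
  by apply: le_measure; rewrite ?inE.
have fAG := fA _ (measurableI _ _ mA mG).
have fAG' := fA _ (measurableI _ _ mA (measurableC mG)).
have E : fine (mu A) = fine (mu (A `&` ~` G)) + fine (mu (A `&` G)).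
  by rewrite -fineD //; congr fine; rewrite -setDE; exact: measureDI.
rewrite -(fineK (fA _ mA)) -(fineK fAG) -(fineK fAG') -!EFinM !lee_fin.
by move=> /negP; rewrite -ltNge; lra.
Qed.

Lemma expr_powR (R : realType) (x alpha : R) (k : nat) :
  0 <= x -> (x ^+ k) `^ alpha = (x `^ alpha) ^+ k.
Proof.
move=> x0; rewrite -[x ^+ k]powR_mulrn //.
by rewrite -[RHS](powR_mulrn _ (powR_ge0 _ _)) -!powRrM [alpha * _]mulrC.
Qed.

Lemma half_expr_lt (R : realType) (e : R) :
  0 < e -> exists N, forall k, (N <= k)%N -> 2^-1 ^+ k < e.
Proof.
move=> e0; have [N] := ltr_add_invr e0; rewrite add0r => Ne.
exists N.+1 => k Nk; apply: le_lt_trans Ne; rewrite exprVn lef_pV2 ?posrE ?exprn_gt0 //.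
rewrite -natrX ler_nat; apply: (leq_trans Nk); exact/ltnW/ltn_expl.
Qed.

Lemma limsup_inhom_negligible (R : realType) (m n : nat)
    (nu : {measure set (borel_mx R m n) -> \bar R}) (E : set 'cV[R]_m)
    (P : nat -> set 'cV[int]_n) (b : 'I_m -> nat) (theta : 'cV[R]_m) :
  contracting_for E nu -> (exists j, (1 < b j)%N) ->
  (forall d t w, E (plane_widths b d t w)) ->
  {ae nu, forall X, exists N, forall k, (N <= k)%N ->
    ~ hom_near (P k) b (2^-1 ^+ k) (X : 'M[R]_(m, n))} ->
  nu.-negligible [set X : 'M[R]_(m, n) | forall N, exists2 k, (N <= k)%N &
    inhom_near (P k) theta b (2^-1 ^+ k) X].
Proof.
move=> [_ fin [lambda l1 dbl] [C [alpha [r0 [C0 alpha0 r00 ctr]]]]] b1 Eb hom.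
set W := (X in nu.-negligible X).
pose S := msupport nu.
pose K (i : nat) := ball (0 : 'M[R]_(m, n)) i.+1%:R.
have l0 : 0 <= lambda by lra.
(* Vitali selection needs bounded sets of centres, hence the exhaustion by the balls [K i]. *)
apply: (@negligibleS _ (borel_mx R m n) _ nu (~` S `|` \bigcup_i (W `&` (S `&` K i)))).
  move=> X WX; have [SX|nSX] := pselect (S X); last by left.
  right; have [i Xi] : exists i : nat, `|X| < i.+1%:R.
    exists (Num.truncn `|X|); exact: truncnS_gt.
  by exists i => //; split=> //; split=> //; rewrite /K -ball_normE /= sub0r normrN.
apply: negligibleU; first exact: msupportC_negligible.
apply: negligible_bigcup => i.
pose G N : set 'M[R]_(m, n) := S `&` \bigcap_(k in [set k | (N <= k)%N])
  ~` hom_near (P k) b (2^-1 ^+ k).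
have mG N : measurable (G N : set (borel_mx R m n)).
  apply: closed_borel_mx; apply: closedI; first exact: closed_msupport.
  by apply: closed_bigI => k _; apply: open_closedC; exact: open_hom_near.
have GC0 : (fun N => nu (~` G N)) @ \oo --> 0%E.
  have -> : 0%E = nu (\bigcap_N ~` G N).
    apply/esym/negligibleP; first by apply: bigcapT_measurable => N; exact: measurableC.
    apply: (@negligibleS _ (borel_mx R m n) _ nu _ _ _
      (negligibleU (msupportC_negligible nu) hom)) => X H.
    have [SX|nSX] := pselect (S X); last by left.
    by right => -[N HN]; apply: (H N) => //; split=> // k; exact: HN.
  apply: nonincreasing_cvg_mu.
  - by apply: le_lt_trans fin; apply: le_measure; rewrite ?inE //; exact: measurableC.
  - by move=> N; exact: measurableC.
  - by apply: bigcapT_measurable => N; exact: measurableC.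
  - move=> N N' NN'; apply/subsetPset => X /= H [SX GX]; apply: H; split=> // k kN'.
    by apply: GX => /=; exact: leq_trans kN'.
pose c := lambda ^+ 3 * 2.
have c0 : 0 <= c by rewrite mulr_ge0 // exprn_ge0.
suff [H HH] : exists H : nat -> set (borel_mx R m n), forall N,
    [/\ measurable (H N), W `&` (S `&` K i) `<=` H N &
    (nu (H N) <= c%:E * nu (~` G N))%E].
  apply: (negligible_of_covers (u := fun N => (c%:E * nu (~` G N))%E)
    (fun N => let: And3 h _ _ := HH N in h) (fun N => let: And3 _ h _ := HH N in h)
    (fun N => let: And3 _ _ h := HH N in h)).
  by rewrite -[0%E](mule0 c%:E); apply: cvgeZl.
suff HE N : exists H : set (borel_mx R m n), [/\ measurable H,
    W `&` (S `&` K i) `<=` H & (nu H <= c%:E * nu (~` G N))%E].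
  by have [H HH] := choice HE; exists H.
pose good : set 'M[R]_(m, n) := [set X | (S `&` K i) X /\ forall r, 0 < r ->
  (nu (ball X r) <= 2%:E * nu (ball X r `&` G N))%E].
pose bad : set 'M[R]_(m, n) := [set X | (S `&` K i) X /\ exists2 r, 0 < r &
  (nu (ball X r) <= 2%:E * nu (ball X r `&` ~` G N))%E].
have gb X : (S `&` K i) X -> good X \/ bad X.
  move=> SX; have [g|ng] := pselect (good X); [by left|right; split=> //].
  apply: contrapT => nb; apply: ng; split=> // r rpos; apply: contrapT => H.
  by apply: nb; exists r => //; apply: measure_half_split => //; exact: ball_borel_mx.
have [B [mB badB nB]] := @maximal_cover R m n nu lambda i.+1%:R l0 dbl bad (~` G N)
  (measurableC (mG N)) (fun X H => H.1) (fun X H => H.2).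
have [K0 HK0] := half_expr_lt r00.
pose t : R := 2^-1 `^ alpha.
have t01 : 0 <= t < 1.
  rewrite powR_ge0 /= (_ : 1 = 1 `^ alpha :> R); last by rewrite powR1.
  by apply: gt0_ltr_powR => //; rewrite ?nnegrE //; lra.
pose M := C * c * fine (nu setT).
have M0 : 0 <= M by rewrite !mulr_ge0 ?fine_ge0 // ltW.
have cover k : exists F : set (borel_mx R m n), [/\ measurable F,
    (nu F <= (M * t ^+ k)%:E)%E & (maxn N (maxn K0 1) <= k)%N ->
    good `&` inhom_near (P k) theta b (2^-1 ^+ k) `<=` F].
  have [kN|_] := boolP (maxn N (maxn K0 1) <= k)%N; last first.
    by exists set0; split=> //; rewrite measure0 lee_fin mulr_ge0 // exprn_ge0 // powR_ge0.
  (* [K0] ensures 2^-k < r0, and k >= 1 ensures 2^-k <= 1/2. *)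
  move: kN; rewrite !geq_max => /and3P[Nk Kk k1].
  have [] := @inhom_near_cover R m n nu E lambda C alpha r0 i.+1%:R b theta l0 dbl C0
    _ ctr b1 Eb (P k) (2^-1 ^+ k) (G N) good _ (HK0 _ Kk) (mG N).
  - by [].
  - by rewrite exprn_gt0 ?invr_gt0 //= -[leRHS]expr1 ler_wiXn2l // ?invr_ge0 // invf_le1 // ler1n.
  - by move=> X [].
  - by apply/seteqP; split=> // X [[_ H] /H]; exact.
  - by move=> X [].
  - by move=> X r [_ H]; exact: H.
  - move=> F [mF FA nF]; exists F; split=> //; apply: (le_trans nF).
    rewrite -(@fineK _ (nu setT)) ?ge0_fin_numE // -EFinM lee_fin.
    by rewrite expr_powR ?invr_ge0 // -/t le_eqVlt /M /c; apply/orP; left; apply/eqP; ring.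
have [F HF] := choice cover.
have lF : nu (lim_sup_set F) = 0%E.
  by apply: (borel_cantelli_geometric t01 M0) => k; case: (HF k).
have mlF : measurable (lim_sup_set F).
  apply: bigcapT_measurable => k; apply: bigcup_measurable => j _.
  by case: (HF j).
exists (B `|` lim_sup_set F); split.
- exact: measurableU.
- move=> X [WX SX]; have [gX|bX] := gb _ SX; last by left; exact: badB.
  right => k _; have [j kj HX] := WX (maxn k (maxn N (maxn K0 1))).
  move: kj; rewrite geq_max => /andP[kj Nj].
  by exists j => //; case: (HF j) => _ _; apply.
- apply: (le_trans (measureU2 _ mB mlF)).
  by rewrite [X in (_ + X)%E]lF adde0.
Qed.

                     

(** * Pigeonhole transference: homogeneous gaps give inhomogeneous solutions *)

Section inhom_solution.
Context (R : realType) (m n : nat) (X : 'M[R]_(m, n)) (N M h : nat).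
Hypothesis (M0 : (0 < M)%N).
Hypothesis (boxes : (M ^ m < h.+1 * N.+1 ^ n)%N).
Hypothesis (hom : forall q : 'cV[int]_n, q != 0 ->
  (forall i, `|q i 0| <= N%:Z) -> forall p : 'cV[int]_m,
  exists j, M%:R^-1 <= `|(X *m intvec R q) j 0 - (p j 0)%:~R|).

Let l (q : 'cV[int]_n) j := (X *m intvec R q) j 0.

Let lD (q q' : 'cV[int]_n) j : l (q + q') j = l q j + l q' j.
Proof. by rewrite /l /intvec map_mxD mulmxDr mxE. Qed.

Let lB (q q' : 'cV[int]_n) j : l (q - q') j = l q j - l q' j.
Proof. by rewrite /l intvecB mulmxBr !mxE. Qed.

(** [d] counts at once multiples of N in the size of q and multiples of 1/M in the error, so adding
    a vector of size at most N with error at most 1/M raises the level by one. *)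
Let good (d : nat) (tau : 'cV[R]_m) := exists (q : 'cV[int]_n) (p : 'cV[int]_m),
  (forall i, `|q i 0| <= (d * N)%N%:Z) /\
  forall j, `|l q j + (p j 0)%:~R - tau j 0| <= d%:R / M%:R.

Let MR0 : (0 : R) < M%:R.
Proof. by rewrite ltr0n. Qed.

Let goodW d d' tau : (d <= d')%N -> good d tau -> good d' tau.
Proof.
move=> dd' [q [p [Hq Hp]]]; exists q, p; split=> [i|j].
  by apply: (le_trans (Hq i)); rewrite lez_nat leq_mul2r dd' orbT.
by apply: (le_trans (Hp j)); rewrite ler_pM2r ?invr_gt0 // ler_nat.
Qed.

Let good_shift d (tau tau' : 'cV[R]_m) (q : 'cV[int]_n) (p : 'cV[int]_m) :
  good d tau -> (forall i, `|q i 0| <= N%:Z) ->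
  (forall j, `|tau' j 0 - tau j 0 - l q j - (p j 0)%:~R| <= M%:R^-1) ->
  good d.+1 tau'.
Proof.
move=> [q0 [p0 [Hq0 Hp0]]] Hq Hp; exists (q0 + q), (p0 + p); split=> [i|j].
  rewrite mxE mulSn PoszD addrC; apply: (le_trans (ler_normD _ _)).
  by apply: lerD; [exact: Hq|exact: Hq0].
rewrite lD !mxE rmorphD /= -natr1 mulrDl mul1r.
have := ler_normB (l q0 j + (p0 j 0)%:~R - tau j 0)
  (tau' j 0 - tau j 0 - l q j - (p j 0)%:~R).
set u := l q0 j + _ - _ - _; set v := l q0 j + _ + _ - _.
have -> : u = v by rewrite /u /v; ring.
have := Hp0 j; have := Hp j; lra.
Qed.

Let good_near d (tau tau' : 'cV[R]_m) : good d tau ->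
  (forall j, `|tau' j 0 - tau j 0| <= M%:R^-1) -> good d.+1 tau'.
Proof.
move=> H near; apply: (good_shift (q := 0) (p := 0) H) => [i|j]; first by rewrite mxE.
by rewrite /l /intvec map_mx0 mulmx0 !mxE !subr0.
Qed.

                                                                      
                                                   
(** Along the segment from 0 to [theta], cut into steps of size at most 1/M, the minimal level
    starts at 0, rises by at most one per step and ends above 2h. So it takes every value 2i with i
    <= h. *)
Let good_levels (theta : 'cV[R]_m) i : ~ good (2 * h) theta -> (i <= h)%N ->
  exists tau, good (2 * i) tau /\ forall d, (d < 2 * i)%N -> ~ good d tau.
Proof.
move=> nth ih.
have good0 : good 0 0.
  exists 0, 0; split=> [k|j]; first by rewrite mxE.
  by rewrite /l /intvec map_mx0 mulmx0 !mxE addr0 subrr normr0 mul0r.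
case: i ih => [_|i ih]; first by exists 0.
pose T := (Num.truncn (M%:R * `|theta|)).+1.
have T0 : (0 : R) < T%:R by rewrite ltr0n.
pose tau (s : nat) : 'cV[R]_m := (s%:R / T%:R) *: theta.
have step s j : `|tau s.+1 j 0 - tau s j 0| <= M%:R^-1.
  rewrite !mxE -mulrBl -mulrBl -natr1 addrAC subrr add0r mul1r normrM.
  rewrite gtr0_norm ?invr_gt0 // mulrC ler_pdivrMr // -[leRHS]mulrC ler_pdivlMr //.
  rewrite mulrC; apply: (@le_trans _ _ (M%:R * `|theta|)); last exact/ltW/truncnS_gt.
  apply: ler_wpM2l; first exact: ltW.
  exact: mx_norm_coord.
have tauT : tau T = theta by rewrite /tau divff ?gt_eqF // scale1r.
have ex : exists s, ~~ `[< good (2 * i).+1 (tau s) >].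
  exists T; apply/asboolPn; rewrite tauT => H; apply: nth; apply: goodW H; lia.
(* At the first point that is not good at level 2i+1, the level is exactly 2i+2. *)
have [[|s] /asboolPn Hs mins] := ex_minnP ex.
  by exfalso; apply: Hs; rewrite /tau mul0r scale0r; apply: goodW good0.
exists (tau s.+1); split.
  rewrite (_ : 2 * i.+1 = (2 * i).+2)%N; last lia.
  apply: (@good_near _ (tau s)) => //.
  by apply: contrapT => /asboolPn /mins; rewrite ltnn.
by move=> d di /(@goodW _ (2 * i).+1) H; apply: Hs; apply: H; lia.
Qed.

Let frac (x : R) := x - (Num.floor x)%:~R.

Let frac_bound x : 0 <= frac x < 1.
Proof. have := floor_itv x; rewrite /frac intrD; lra. Qed.

Let box_subproof x : (Num.truncn (M%:R * frac x) < M)%N.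
Proof.
have /andP[f0 f1] := frac_bound x.
rewrite -(ltr_nat R); apply: (@le_lt_trans _ _ (M%:R * frac x)).
  by have /andP[] := truncn_itv (mulr_ge0 (ltW MR0) f0).
by rewrite gtr_pMr.
Qed.

Let box x := Ordinal (box_subproof x).

Let box_eq x y : box x = box y ->
  `|x - y - (Num.floor x - Num.floor y)%:~R| < M%:R^-1.
Proof.
move=> /(congr1 val) /= E.
have /andP[fx _] := frac_bound x; have /andP[fy _] := frac_bound y.
have := truncn_itv (mulr_ge0 (ltW MR0) fx); have := truncn_itv (mulr_ge0 (ltW MR0) fy).
rewrite E; move: (Num.truncn _) => k; rewrite -natr1 => /andP[y1 y2] /andP[x1 x2].
have -> : x - y - (Num.floor x - Num.floor y)%:~R = frac x - frac y.
  by rewrite /frac rmorphB /=; ring.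
rewrite -(ltr_pM2l MR0) mulfV ?gt_eqF // -{1}(gtr0_norm MR0) -normrM mulrBr.
by rewrite ltr_norml; lra.
Qed.

(** Otherwise take points [tau i] of exact level 2i for all i <= h. By [boxes], two of the points
    [tau i] - X q, with q in [0, N]^n, share a box of side 1/M modulo 1. If the levels differ, the
    higher point is one level above the lower at most, although levels are spaced by 2; if they
    agree, the difference of the vectors q contradicts [hom]. *)
Lemma inhom_approx theta : good (2 * h) theta.
Proof.
apply: contrapT => nth.
have lev (i : 'I_h.+1) : exists tau, good (2 * i) tau /\
    forall d, (d < 2 * i)%N -> ~ good d tau.
  by apply: (good_levels nth); rewrite -ltnS.
have [tau Htau] := choice lev.
pose vec (q : {ffun 'I_n -> 'I_N.+1}) : 'cV[int]_n := \col_i (q i : nat)%:Z.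
have vec_bound q q' i : `|(vec q - vec q') i 0| <= N%:Z.
  by rewrite !mxE; have := ltn_ord (q i); have := ltn_ord (q' i); lia.
pose f (x : 'I_h.+1 * {ffun 'I_n -> 'I_N.+1}) : {ffun 'I_m -> 'I_M} :=
  [ffun j => box (tau x.1 j 0 - l (vec x.2) j)].
have ninj : ~ injective f.
  move=> /leq_card; rewrite card_prod !card_ffun !card_ord.
  by move: boxes; rewrite ltnNge => /negP.
have [x [y [fxy xy]]] : exists x y, f x = f y /\ x <> y.
  apply: contrapT => H; apply: ninj => x y fxy; apply: contrapT => xy.
  by apply: H; exists x, y.
pose p x y : 'cV[int]_m := \col_j (Num.floor (tau x.1 j 0 - l (vec x.2) j) -
  Num.floor (tau y.1 j 0 - l (vec y.2) j)).
have key x' y' : f x' = f y' -> forall j, `|tau x'.1 j 0 - tau y'.1 j 0 -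
    l (vec x'.2 - vec y'.2) j - (p x' y' j 0)%:~R| < M%:R^-1.
  move=> /ffunP fE j; have := fE j; rewrite !ffunE => /box_eq.
  rewrite lB !mxE; congr (`|_| < _); ring.
have lt_levels x' y' : f x' = f y' -> (y'.1 < x'.1)%N -> False.
  move=> fE yx; have [gy _] := Htau y'.1; have [_ ngx] := Htau x'.1.
  apply: (ngx (2 * y'.1).+1); first lia.
  by apply: (good_shift gy (vec_bound x'.2 y'.2)) => j; exact/ltW/key.
case: (ltngtP x.1 y.1) => [|| /val_inj E]; [exact: lt_levels|exact: lt_levels|].
have vxy : vec y.2 - vec x.2 != 0.
  apply/eqP => V; apply: xy; case: x y E V {fxy} => [x1 x2] [y1 y2] /= -> V.
  congr pair; apply/ffunP => i; apply/val_inj.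
  by have := congr1 (fun v : 'cV[int]_n => v i 0) V; rewrite !mxE /= => /eqP;
  rewrite subr_eq0 => /eqP[].
have [j] := hom vxy (vec_bound _ _) (p x y).
rewrite leNgt => /negP; apply; have := key _ _ fxy j.
by rewrite E subrr sub0r -/(l _ j) !lB; congr (`|_| < _); ring.
Qed.

Lemma inhom_solution (theta : 'cV[R]_m) : (0 < n)%N ->
  exists q : 'cV[int]_n, [/\ q != 0,
    forall i, `|q i 0| <= (4 * h * N).+1%:Z &
    exists p : 'cV[int]_m, forall j,
      `|(X *m intvec R q + theta) j 0 - (p j 0)%:~R| <= (2 * h)%:R / M%:R].
Proof.
(* Shifting by [q1], whose entries exceed 2hN, makes the solution nonzero; the target is corrected
   accordingly. *)
move=> n0; pose q1 : 'cV[int]_n := const_mx (2 * h * N).+1%:Z.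
have [q [p [Hq Hp]]] := inhom_approx (- theta - X *m intvec R q1).
exists (q + q1); split.
- apply/eqP => E; have := congr1 (fun v : 'cV[int]_n => v (Ordinal n0) 0) E.
  rewrite !mxE; have := Hq (Ordinal n0); move: (q _ _) (2 * h * N)%N => u v; lia.
- move=> i; rewrite !mxE; have := Hq i.
  rewrite (_ : 4 * h * N = 2 * (2 * h * N))%N; last lia.
  move: (q i 0) (2 * h * N)%N => u v; lia.
- exists (- p) => j; apply: le_trans (Hp j).
  have -> : (X *m intvec R (q + q1) + theta) j 0 = l q j + l q1 j + theta j 0.
    by rewrite -lD mxE.
  rewrite le_eqVlt; apply/orP; left; apply/eqP; congr (`|_|).
  by rewrite [(- p) _ _]mxE [(_ - _ : 'cV[R]_m) _ _]mxE ![(- (_ : 'cV[R]_m)) _ _]mxE -/(l q1 j) rmorphN /=; ring.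
Qed.

End inhom_solution.

(** * The lower bound for the exponents *)

Lemma mx_norm_le (R : realType) (m n : nat) (A : 'M[R]_(m, n)) (e : R) :
  0 <= e -> (forall i j, `|A i j| <= e) -> `|A| <= e.
Proof.
by move=> e0 Ae; rewrite -[`|A|]/(mx_norm A) mx_normrE; apply: bigmax_le => // -[i j] _.
Qed.

Lemma centred_frac_half (R : realType) (m : nat) (y : 'cV[R]_m) j :
  `|centred_frac y j 0| <= 2^-1.
Proof.
rewrite mxE; have := floor_itv (y j 0 + 2^-1); rewrite intrD.
by move=> /andP[? ?]; rewrite ler_norml; apply/andP; split; lra.
Qed.

Lemma centred_frac_le (R : realType) (m : nat) (y : 'cV[R]_m) j (z : int) :
  `|centred_frac y j 0| <= `|y j 0 - z%:~R|.
Proof.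
have := centred_frac_half y j; rewrite mxE; set f := Num.floor _ => H.
have [->//|zf] := eqVneq z f.
have : 1 <= `|f%:~R - z%:~R : R|.
  by rewrite -rmorphB /= -intr_norm -[1]/(1%:~R) ler_int -gtz0_ge1 normr_gt0 subr_eq0 eq_sym.
have := ler_normB (y j 0 - z%:~R) (y j 0 - f%:~R).
have -> : y j 0 - z%:~R - (y j 0 - f%:~R) = f%:~R - z%:~R by ring.
lra.
Qed.

Lemma dist_int_le (R : realType) (m : nat) (y : 'cV[R]_m) (p : 'cV[int]_m) (e : R) :
  0 <= e -> (forall j, `|y j 0 - (p j 0)%:~R| <= e) -> dist_int y <= e.
Proof.
move=> e0 H; apply: mx_norm_le => // j k; rewrite ord1.
by apply: le_trans (H j); exact: centred_frac_le.
Qed.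

Lemma dist_int_lt (R : realType) (m : nat) (y : 'cV[R]_m) (p : 'cV[int]_m) (e : R) :
  0 < e -> (forall j, `|y j 0 - (p j 0)%:~R| < e) -> dist_int y < e.
Proof.
move=> e0 H; rewrite /dist_int -[`|_|]/(mx_norm _) mx_normrE.
apply: bigmax_lt => // -[j k] _; rewrite ord1.
by apply: le_lt_trans (H j); exact: centred_frac_le.
Qed.

Lemma intvec_norm_le (R : realType) (n : nat) (q : 'cV[int]_n) (N : nat) :
  (forall i, `|q i 0| <= N%:Z) -> `|intvec R q| <= N%:R.
Proof.
move=> H; apply: mx_norm_le => // i k; rewrite ord1 mxE -intr_norm -[N%:R]/(N%:~R).
by rewrite ler_int.
Qed.

Lemma intvec_norm_ge1 (R : realType) (n : nat) (q : 'cV[int]_n) :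
  q != 0 -> 1 <= `|intvec R q|.
Proof.
move=> q0; have [i qi] := intvec_coord_ge1 R q0.
by apply: le_trans (mx_norm_coord _ i 0); rewrite mxE.
Qed.

Lemma ereal_sup_le1 (R : realType) (S : set R) (w : R) :
  (ereal_sup [set x%:E | x in S] <= 1)%E -> 1 < w -> ~ S w.
Proof.
move=> H w1 Sw; have : (w%:E <= 1)%E by apply: (le_trans _ H); apply: ereal_sup_ubound; exists w.
by rewrite lee_fin leNgt w1.
Qed.

(** The sup norm to the power m dominates the product of coordinates, and for q != 0 the product
    [prod_plus] is at most |q|^n. *)
Lemma exponent_le_mult (R : realType) (m n : nat) (X : 'M[R]_(m, n)) (theta : 'cV[R]_m) :
  (exponent X theta <= mult_exponent X theta)%E.
Proof.
apply: le_ereal_sup => _ [w [w0 H] <-]; exists w => //; split=> // Q0.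
have [Q [Q0Q Q1 [q [q0 dq nq]]]] := H Q0; exists Q; split=> //; exists q; split=> //.
  apply: le_lt_trans dq; rewrite /prod_abs -[X in _ ^+ X]card_ord -prodr_const.
  by apply: ler_prod => j _; rewrite normr_ge0 /=; exact: mx_norm_coord.
apply: le_trans nq; rewrite /prod_plus -[X in _ ^+ X]card_ord -prodr_const.
apply: ler_prod => i _; rewrite ge_max le_max ler01 /= intvec_norm_ge1 //=.
by apply: le_trans (mx_norm_coord _ i 0); rewrite mxE.
Qed.

Lemma ltr_pow2 (R : realType) (x y : R) : x < y -> 2 `^ x < 2 `^ y.
Proof.
move=> xy; rewrite lt_neqAle ler_powR ?ltW ?ltr1n // andbT.
have y0 : 2 `^ x != 0 :> R by rewrite gt_eqF // powR_gt0.
apply/eqP => E; have : 2 `^ (y - x) = 1.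
  by rewrite powRB ?pnatr_eq0 ?implybT // -E divff.
by move/eqP; rewrite powR_eq1 => /or3P[/eqP| |/eqP]; lra.
Qed.

Lemma pow2_large (R : realType) (Q : R) :
  exists K : nat, forall k : nat, (K <= k)%N -> Q < 2 `^ k%:R.
Proof.
exists (Num.truncn `|Q|).+1 => k Kk; rewrite powR_mulrn //.
apply: (le_lt_trans (ler_norm _)); apply: (lt_trans (truncnS_gt _)).
by rewrite -natrX ltr_nat; apply: (leq_ltn_trans Kk); exact: ltn_expl.
Qed.

(** Final comparison of powers of 2 in [exponent_ge1], where x, u, v, a stand for k, m, n, A. *)
Lemma transference_exponents (R : realFieldType) (x u v a w : R) :
  0 <= w < 1 -> 1 <= u -> 1 <= v -> v + u < a * (1 - w) -> u + 3 * v + 1 <= x ->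
  (1 + x * u - x * (v * a + 1)) * u < v * (3 + x * u * (a + 1)) * - w.
Proof.
move=> /andP[w0 w1] u1 v1 auv xuv.
have h1 : v * (v + u) < v * (a * (1 - w)) by rewrite ltr_pM2l; lra.
have h2 : v + u <= v * (v + u) by rewrite ler_peMl; lra.
have h3 : w * v <= v by rewrite ler_piMl; lra.
pose B := v * (a * (1 - w)) + 1 - u - w * v.
have B1 : 1 <= B by rewrite /B; lra.
have h4 : x <= x * u by rewrite ler_peMr //; lra.
have h5 : x * u <= x * u * B by rewrite ler_peMr //; lra.
rewrite -subr_gt0 (_ : _ - _ = x * u * B - u - 3 * (w * v)); first lra.
by rewrite /B; ring.
Qed.

(** [inhom_solution] lengthens q by a factor of order h and multiplies the error 1/M by 2h. With h a
    small power of N the exponent loses less than [e]. *)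
Lemma exponent_ge1 (R : realType) (m n : nat) (X : 'M[R]_(m, n)) (theta : 'cV[R]_m) :
  (0 < m)%N -> (0 < n)%N ->
  (exponent X 0 <= 1)%E -> (1 <= exponent X theta)%E.
Proof.
move=> m0 n0 X1; apply/lee_subgt0Pr => e e0.
pose w := Num.max 0 (1 - e).
have w01 : 0 <= w < 1 by rewrite /w le_max lexx gt_max ltr01 /=; lra.
apply: (@le_trans _ _ w%:E); first by rewrite -EFinB lee_fin le_max lexx orbT.
apply: ereal_sup_ubound; exists w => //; split=> [|Q0]; first by case/andP: w01.
have mR : (1 : R) <= m%:R by rewrite ler1n.
have nR : (1 : R) <= n%:R by rewrite ler1n.
pose A := (Num.truncn ((n%:R + m%:R) / (1 - w))).+1.
have AR : n%:R + m%:R < A%:R * (1 - w).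
  by rewrite -ltr_pdivrMr ?truncnS_gt //; lra.
have A1 : (1 : R) <= A%:R by rewrite ler1n.
have nA1 : 1 <= n%:R * A%:R :> R by rewrite -natrM ler1n muln_gt0 n0.
(* Breaking the gap 1/M at height N would need the rate 1 + 1/(nA); the excess is halved to leave
   room. *)
have w1 : 1 < 1 + (2 * (n%:R * A%:R))^-1 :> R.
  by rewrite ltrDl invr_gt0; lra.
have [Q1 HQ1] : exists Q1, forall Q : R, Q1 < Q -> 1 < Q -> forall q, q != 0 ->
    `|intvec R q| ^+ n <= Q -> Q `^ (- (1 + (2 * (n%:R * A%:R))^-1)) <= dist_int (X *m intvec R q + 0) ^+ m.
  apply: contrapT => H; apply: (ereal_sup_le1 X1 w1); split; first by lra.
  move=> Q1; apply: contrapT => H'; apply: H; exists Q1 => Q QQ Q1' q q0 qQ.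
  rewrite leNgt; apply/negP => dq; apply: H'.
  by exists Q; split => //; exists q.
have [K0 HK0] := pow2_large Q0; have [K1 HK1] := pow2_large Q1.
pose k := maxn (maxn K0 K1) (m + 3 * n).+1.
have kR : m%:R + 3 * n%:R + 1 <= k%:R :> R.
  by rewrite -natrM -natrD natr1 ler_nat /k leq_max leqnn orbT.
(* Chosen so that M^m = h N^n, just under the pigeonhole threshold; h is N to the power 1/A. *)
pose h := (2 ^ (k * m))%N; pose N := (2 ^ (k * (m * A)))%N; pose M := (2 ^ (k * (n * A + 1)))%N.
have toR j : (2 ^ j)%N%:R = 2 `^ j%:R :> R by rewrite natrX powR_mulrn.
have pw j i : (2 `^ j) ^+ i = 2 `^ (j * i%:R) :> R.
  by rewrite -powR_mulrn ?powR_ge0 // -powRrM.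
have boxes : (M ^ m < h.+1 * N.+1 ^ n)%N.
  have -> : (M ^ m = h * N ^ n)%N.
    rewrite /M /h /N -!expnM -expnD; congr (_ ^ _)%N; ring.
  by apply: ltn_mul; rewrite ?ltnS // ltn_exp2r.
have hom (q : 'cV[int]_n) : q != 0 -> (forall i, `|q i 0| <= N%:Z) -> forall p : 'cV[int]_m,
    exists j, M%:R^-1 <= `|(X *m intvec R q) j 0 - (p j 0)%:~R|.
  move=> q0 qN p; apply: contrapT => H.
  have MR0 : (0 : R) < M%:R^-1 by rewrite invr_gt0 ltr0n expn_gt0.
  have : dist_int (X *m intvec R q + 0) < M%:R^-1.
    rewrite addr0; apply: (dist_int_lt (p := p) MR0) => j; rewrite ltNge; apply/negP => Hj.
    by apply: H; exists j.
  move=> dM; have : dist_int (X *m intvec R q + 0) ^+ m < M%:R^-1 ^+ m.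
    by rewrite ltr_pXn2r // nnegrE ?normr_ge0 // ltW.
  apply/negP; rewrite -leNgt.
  apply: (@le_trans _ _ ((2 `^ (k%:R * (m%:R * A%:R) * n%:R)) `^
      (- (1 + (2 * (n%:R * A%:R))^-1)))).
    rewrite /M toR -powRN pw -powRrM; apply: ler_powR; first by rewrite ler1n.
    rewrite !natrM natrD natrM !mulNr mulrN lerN2.
    have -> : k%:R * (m%:R * A%:R) * n%:R * (1 + (2 * (n%:R * A%:R))^-1) =
        k%:R * (n%:R * A%:R) * m%:R + k%:R * m%:R / 2 :> R.
      by field; rewrite !gt_eqF //; lra.
    have : 0 <= k%:R * m%:R :> R by rewrite mulr_ge0.
    move: (k%:R) (m%:R) (n%:R) (A%:R) => x y z u; lra.
  apply: HQ1 => //.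
  - apply: (lt_le_trans (HK1 k _)); first by rewrite /k !leq_max leqnn orbT.
    apply: ler_powR; first by rewrite ler1n.
    by rewrite -!natrM ler_nat -mulnA leq_pmulr // !muln_gt0 m0 n0.
  - rewrite -[ltLHS](@powRr0 R 2); apply: ltr_pow2.
    by rewrite -!natrM ltr0n !muln_gt0 m0 n0 /k leq_max orbT.
  - rewrite -pw -natrM -natrM -toR.
    by apply: lerXn2r; rewrite ?nnegrE //; exact: intvec_norm_le.
have [q [q0 qN [p Hp]]] := inhom_solution (expn_gt0 2 _ : (0 < M)%N) boxes hom theta n0.
pose S : R := n%:R * (3 + k%:R * m%:R * (A%:R + 1)).
have kS : k%:R <= S.
  have k0 : (0 : R) <= k%:R by [].
  have km : k%:R <= k%:R * m%:R :> R by rewrite ler_peMr.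
  have kmA : k%:R * m%:R <= k%:R * m%:R * (A%:R + 1) :> R.
    by rewrite ler_peMr ?lerDr // mulr_ge0.
  have le3 : k%:R <= 3 + k%:R * m%:R * (A%:R + 1) :> R by lra.
  by apply: (le_trans le3); rewrite /S ler_peMl //; lra.
exists (2 `^ S); split.
- apply: (lt_le_trans (HK0 k _)); first by rewrite /k !leq_max leqnn.
  by apply: ler_powR => //; rewrite ler1n.
- rewrite -[ltLHS](@powRr0 R 2); apply: ltr_pow2; apply: lt_le_trans kS; lra.
exists q; split=> //.
- rewrite -powRrM; apply: (@le_lt_trans _ _ ((2 `^ (1 + k%:R * m%:R - k%:R * (n%:R * A%:R + 1))) ^+ m)).
    apply: lerXn2r; rewrite ?nnegrE ?powR_ge0 ?normr_ge0 //.
    apply: (dist_int_le (p := p)); first exact: powR_ge0.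
    move=> j; apply: le_trans (Hp j) _; rewrite /h /M natrM !toR -powRN.
    rewrite [leRHS]powRD ?pnatr_eq0 ?implybT // [2 `^ (1 + _)]powRD ?pnatr_eq0 ?implybT //.
    by rewrite powRr1 // !natrM natrD natrM.
  rewrite pw; apply: ltr_pow2; rewrite /S.
  exact: transference_exponents.
- rewrite /S [n%:R * _]mulrC -pw; apply: lerXn2r; rewrite ?nnegrE ?powR_ge0 ?normr_ge0 //.
  apply: (le_trans (intvec_norm_le R qN)).
  apply: (@le_trans _ _ (8 * h * N)%N%:R).
    have : (0 < h * N)%N by rewrite muln_gt0 !expn_gt0.
    move=> hN; rewrite ler_nat -!mulnA -addn1 (mulnDl 4 4) leq_add2l.
    by apply: (leq_trans hN); exact: leq_pmull.
  rewrite !natrM !toR (_ : 8 = 2 `^ 3%:R :> R); last by rewrite powR_mulrn //; lra.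
  rewrite -!powRD ?pnatr_eq0 ?implybT //; apply: ler_powR; first by rewrite ler1n.
  by rewrite !natrM; lra.
Qed.

                                             

(** * Dyadic form of the exponents *)

Definition approximable (R : realType) (n : nat) (f g : 'cV[int]_n -> R) (w : R) :=
  forall Q0 : R, exists Q : R, [/\ Q0 < Q, 1 < Q &
    exists q : 'cV[int]_n, [/\ q != 0, f q < Q `^ (- w) & g q <= Q]].

Lemma approx_gt1 (R : realType) (n : nat) (f g : 'cV[int]_n -> R) :
  ~ (ereal_sup [set w%:E | w in [set w : R | (0 <= w)%R /\ approximable f g w]] <= 1)%E ->
  exists h : nat, approximable f g (1 + h.+1%:R^-1).
Proof.
move=> /negP; rewrite -ltNge => /ereal_sup_gt[_ [w [w0 fw] <-]].
rewrite lte_fin => /ltr_add_invr[h hw]; exists h => Q0.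
have [Q [Q0Q Q1 [q [q0 fq gq]]]] := fw Q0; exists Q; split => //; exists q; split=> //.
by apply: (lt_le_trans fq); apply: ler_powR; rewrite ?lerN2 ltW.
Qed.

Lemma pow2_half (R : realType) (k D : nat) :
  (2^-1 ^+ k) ^+ D = 2 `^ (- (k%:R * D%:R)) :> R.
Proof. by rewrite powRN -natrM powR_mulrn // -exprM exprVn. Qed.

(** With A = H L the number A (1 + 1/H) = A + L is an integer. The free parameter L is the gain from
    which later bounded losses are paid. *)
Lemma approx_dyadic (R : realType) (n : nat) (f g : 'cV[int]_n -> R) (H L : nat) :
  (0 < H * L)%N -> approximable f g (1 + H%:R^-1) ->
  forall N, exists2 k, (N <= k)%N & exists q, [/\ q != 0,
    f q < (2^-1 ^+ k) ^+ (H * L + L) & g q < (2 ^+ k) ^+ (H * L).+1].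
Proof.
move=> A0 fg N; set A := (H * L)%N.
have H0 : (0 : R) < H%:R by move: A0; rewrite ltr0n muln_gt0 => /andP[].
(* This makes the dyadic index k of [Q] at least A, so that (2^(k+1))^A <= (2^k)^(A+1). *)
have [Q [Q0 Q1 [q [q0 fq gq]]]] := fg ((2 ^+ maxn N A) ^+ A).
have ex : exists k, Q < (2 ^+ k) ^+ A.
  have [K HK] := pow2_large Q; exists K.
  rewrite -exprM; apply: (lt_le_trans (HK _ (leqnn K))).
  by rewrite powR_mulrn //; apply: ler_weXn2l; rewrite ?ler1n // leq_pmulr.
have mono i j : (i <= j)%N -> (2 ^+ i) ^+ A <= (2 ^+ j) ^+ A :> R.
  by move=> ij; rewrite -!exprM; apply: ler_weXn2l; rewrite ?ler1n // leq_mul2r ij orbT.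
have [[|k] Qk mink] := ex_minnP ex.
  by exfalso; move: Qk; rewrite expr0 expr1n; lra.
have kQ : (2 ^+ k) ^+ A <= Q by rewrite leNgt; apply/negP => /mink; rewrite ltnn.
have : (maxn N A <= k)%N.
  rewrite leqNgt -ltnS; apply/negP => kN; have := mono k.+1 (maxn N A) kN; lra.
rewrite geq_max => /andP[Nk Ak]; exists k => //; exists q; split=> //.
  apply: (lt_le_trans fq); rewrite pow2_half natrD.
  have -> : k%:R * (A%:R + L%:R) = (k * A)%N%:R * (1 + H%:R^-1) :> R.
    by rewrite /A !natrM; field; rewrite gt_eqF.
  have w0 : 0 <= 1 + H%:R^-1 :> R by rewrite addr_ge0 // invr_ge0 ltW.
  rewrite !powRN lef_pV2 ?posrE ?powR_gt0 //; last by lra.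
  rewrite powRrM powR_mulrn // exprM.
  by apply: ge0_ler_powR; rewrite // nnegrE; [rewrite !exprn_ge0|lra].
apply: (le_lt_trans gq); apply: (lt_le_trans Qk); rewrite -!exprM.
by apply: ler_weXn2l; rewrite ?ler1n // mulSn mulnS leq_add2r.
Qed.

Lemma approx_of_dyadic (R : realType) (n : nat) (f g : 'cV[int]_n -> R) (D E : nat) :
  (0 < E)%N ->
  (forall N, exists2 k, (N <= k)%N & exists q, [/\ q != 0,
    f q < (2^-1 ^+ k) ^+ D & g q <= (2 ^+ k) ^+ E]) ->
  approximable f g (D%:R / E%:R).
Proof.
move=> E0 fg Q0; have [K HK] := pow2_large Q0.
have [k Kk [q [q0 fq gq]]] := fg K.+1.
have kE : (2 ^+ k) ^+ E = 2 `^ (k * E)%N%:R :> R by rewrite -exprM powR_mulrn.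
exists ((2 ^+ k) ^+ E); rewrite kE; split.
- by apply: HK; apply: (leq_trans (ltnW Kk)); rewrite leq_pmulr.
- rewrite -[ltLHS](@powRr0 R 2); apply: ltr_pow2; rewrite ltr0n muln_gt0 E0 andbT.
  exact: leq_ltn_trans (leq0n K) Kk.
- exists q; split=> //; last by rewrite -kE.
  rewrite -powRrM; apply: (lt_le_trans fq); rewrite pow2_half natrM.
  by rewrite (_ : k%:R * E%:R * - (D%:R / E%:R) = - (k%:R * D%:R)) //; field; rewrite pnatr_eq0 -lt0n.
Qed.

(** * The upper bound, contracting case *)

Lemma negligible_of_local_contracting (R : realType) (m n : nat)
    (mu : {measure set (borel_mx R m n) -> \bar R}) (E : set 'cV[R]_m)
    (good bad : set 'M[R]_(m, n)) :
  (forall nu : {measure set (borel_mx R m n) -> \bar R},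
    contracting_for E nu -> {ae nu, forall X, good X} -> nu.-negligible bad) ->
  {ae mu, forall X0, exists (U : set (borel_mx R m n)) (mU : measurable U),
    nbhs (X0 : 'M[R]_(m, n)) U /\ contracting_for E (mrestr mu mU)} ->
  {ae mu, forall X, good X} -> mu.-negligible bad.
Proof.
move=> loc ctr gd.
pose loc_ctr : set 'M[R]_(m, n) := fun X0 => exists (U : set (borel_mx R m n))
  (mU : measurable U), nbhs X0 U /\ contracting_for E (mrestr mu mU).
have nloc : mu.-negligible (~` loc_ctr) by exact: ctr.
apply: (@negligibleS _ (borel_mx R m n) _ mu (~` loc_ctr `|` (bad `&` loc_ctr))).
  by move=> X bX; have [?|?] := pselect (loc_ctr X); [right|left].
apply: negligibleU => //; apply: negligible_local => X [_ [U [mU [UX ctrU]]]].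
exists U => //.
have gdU : {ae mrestr mu mU, forall X, good X}.
  have [N [mN N0 gN]] := gd; exists N; split=> //.
  apply/eqP; rewrite eq_le measure_ge0 andbT -N0 /mrestr.
  by apply: le_measure; rewrite ?inE //; exact: measurableI.
have [N [mN N0 bN]] := loc _ ctrU gdU.
exists (N `&` U); split=> //; first exact: measurableI.
by move=> Y [[/bN NY _] UY].
Qed.

Lemma exponent_le1_negligible (R : realType) (m n : nat) (theta : 'cV[R]_m)
    (nu : {measure set (borel_mx R m n) -> \bar R}) : (0 < m)%N ->
  contracting nu ->
  {ae nu, forall X : 'M[R]_(m, n), (exponent X 0 <= 1)%E} ->
  nu.-negligible [set X : 'M[R]_(m, n) | ~ (exponent X theta <= 1)%E].
Proof.
move=> m0 ctr hom.
pose V (h : nat) := [set X : 'M[R]_(m, n) | approximable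
  (fun q => dist_int (X *m intvec R q + theta) ^+ m)
  (fun q => `|intvec R q| ^+ n) (1 + h.+1%:R^-1)].
apply: (@negligibleS _ (borel_mx R m n) _ nu (\bigcup_h V h)).
  by move=> X /approx_gt1[h Vh]; exists h.
apply: negligible_bigcup => h.
                                                                      
                                                              
(* As A + L = M m, the approximation bound becomes 2^(-kM) in each coordinate. Differences of
   solutions keep the exponent (M-2) m = A + 3m, which exceeds the height exponent A + 2. *)
pose L := (5 * m)%N; pose A := (h.+1 * L)%N; pose M := (5 * h.+2)%N.
have AL : (A + L = M * m)%N by rewrite /A /L /M; ring.
have A0 : (0 < A)%N by rewrite !muln_gt0.
pose P (k : nat) := [set q : 'cV[int]_n | `|intvec R q| ^+ n < (2 ^+ k) ^+ A.+1].
have M1 : (1 < M)%N by rewrite /M; lia.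
have half_gt0 k : (0 : R) < 2^-1 ^+ k by rewrite exprn_gt0 ?invr_gt0.
apply: (@negligibleS _ (borel_mx R m n) _ nu _ _ _
  (@limsup_inhom_negligible R m n nu _ P (fun=> M) theta ctr _ _ _)); first last.
- apply: (@negligibleS _ (borel_mx R m n) _ nu _ _ _ hom) => X nX X1; apply: nX.
  apply: contrapT => nX.
  have [D1 D2] : (1 < A.+2 /\ A.+2 < (M - 2) * m)%N.
    by split=> //; rewrite mulnBl -AL /L; lia.
  apply: (ereal_sup_le1 X1 (w := ((M - 2) * m)%N%:R / A.+2%:R)).
    by rewrite ltr_pdivlMr ?ltr0n // mul1r ltr_nat.
  split; first by rewrite divr_ge0.
  apply: approx_of_dyadic => // N.
  (* k >= n lets one extra factor 2^k absorb the 2^n coming from |q - q'| <= 2t. *)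
  have [k Nk [q [q' [p [Pq Pq' qq' Hp]]]]] : exists2 k, (maxn N n <= k)%N & hom_near (P k) (fun=> M) (2^-1 ^+ k) X.
    apply: contrapT => H; apply: nX; exists (maxn N n) => k Nk Hk; apply: H.
    by exists k.
  move: Nk; rewrite geq_max => /andP[Nk nk].
  exists k => //; exists (q - q'); split; first by rewrite subr_eq0.
    rewrite addr0 exprM ltr_pXn2r ?nnegrE ?normr_ge0 ?exprn_ge0 // 1?ltW //.
    by apply: (dist_int_lt (p := p)); [exact: exprn_gt0|move=> j; exact: Hp].
  pose t := Num.max `|intvec R q| `|intvec R q'|.
  have tE : t ^+ n < (2 ^+ k) ^+ A.+1 by rewrite /t maxEle; case: ifP.
  apply: (@le_trans _ _ ((2 * t) ^+ n)).
    apply: lerXn2r; rewrite ?nnegrE ?mulr_ge0 ?le_max ?normr_ge0 // intvecB.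
    apply: (le_trans (ler_normB _ _)).
    have : `|intvec R q| <= t by rewrite le_max lexx.
    have : `|intvec R q'| <= t by rewrite le_max lexx orbT.
    lra.
  rewrite exprMn exprS; apply: ler_pM; rewrite ?exprn_ge0 ?le_max ?normr_ge0 ?(ltW tE) //.
  by apply: ler_weXn2l => //; rewrite ler1n.
- by move=> d t w i j; rewrite !mxE.
- by exists (Ordinal m0).
- move=> X VX N; have [k Nk [q [q0 dq gq]]] := approx_dyadic A0 VX N.
  exists k => //; exists q; split=> //.
  exists (\col_j Num.floor ((X *m intvec R q + theta) j 0 + 2^-1)) => j _.
  move: dq; rewrite -/A AL exprM ltr_pXn2r ?nnegrE ?normr_ge0 ?exprn_ge0 // 1?ltW // => dq.
  by apply: le_lt_trans dq; apply: le_trans (mx_norm_coord _ j 0); rewrite [centred_frac _ _ _]mxE [X in _ - X%:~R]mxE.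
Qed.

(** * The upper bound, strongly contracting case *)

Lemma dyadic_bracket (R : realType) (z x : R) (N : nat) :
  1 <= x -> x < z ^+ N -> exists a : nat, [/\ (0 < a <= N)%N, x < z ^+ a & z ^+ a.-1 <= x].
Proof.
move=> x1 xN; have ex : exists a, x < z ^+ a by exists N.
have [a xa mina] := ex_minnP ex.
have a0 : (0 < a)%N by rewrite lt0n; apply: contraTneq xa => ->; rewrite expr0 -leNgt.
exists a; split => //; first by rewrite a0 mina.
by rewrite leNgt; apply/negP => /mina; rewrite leqNgt ltn_predL a0.
Qed.

(** Rounding each factor up to a power of z costs at most one exponent per coordinate. *)
Lemma prod_plus_pattern (R : realType) (n A : nat) (z : R) (q : 'cV[int]_n) :
  1 < z -> prod_plus R q < z ^+ A.+1 ->
  exists a : {ffun 'I_n -> 'I_A.+2}, (\sum_i a i <= A + n)%N /\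
    forall i, Num.max 1 `|(q i 0)%:~R| < z ^+ a i.
Proof.
move=> z1 qz; pose x i : R := Num.max 1 `|(q i 0)%:~R|.
have x1 i : 1 <= x i by rewrite le_max lexx.
have xq i : x i <= prod_plus R q.
  rewrite /prod_plus (bigD1 i) //= -/(x i) ler_peMr //; first by apply: le_trans (x1 i).
  by apply: (big_ind (fun t => 1 <= t)) => // [u v|j _]; [exact: mulr_ege1|exact: x1].
have H i : exists a : 'I_A.+2, [/\ (0 < a)%N, x i < z ^+ a & z ^+ a.-1 <= x i].
  have [a [/andP[a0 aA] xa ax]] := dyadic_bracket (x1 i) (le_lt_trans (xq i) qz).
  by exists (Ordinal (aA : (a < A.+2)%N)).
have [a Ha] := choice H; exists [ffun i => a i]; split; last first.
  by move=> i; rewrite ffunE; case: (Ha i).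
under eq_bigr do rewrite ffunE.
have -> : (\sum_i a i = \sum_i (a i).-1 + n)%N.
  rewrite -[X in (_ + X)%N]card_ord -sum1_card -big_split /=; apply: eq_bigr => i _.
  by rewrite addn1 prednK //; case: (Ha i).
rewrite leq_add2r -ltnS -(ltr_eXn2l z1); apply: le_lt_trans qz.
rewrite -prodrXr; apply: ler_prod => i _; rewrite exprn_ge0 ?(le_trans _ (ltW z1)) //=.
by case: (Ha i).
Qed.

(** Each [b j] is the largest admissible exponent, capped at B since [y j] may be 0. A capped
    coordinate alone reaches B; otherwise each y j is at least d^(b j + 1). *)
Lemma prod_pattern (R : realType) (m B : nat) (d : R) (y : 'I_m -> R) :
  0 < d < 1 -> (forall j, 0 <= y j < 1) -> \prod_j y j < d ^+ B ->
  exists b : {ffun 'I_m -> 'I_B.+1}, (B <= \sum_j b j + m)%N /\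
    forall j, y j < d ^+ b j.
Proof.
move=> /andP[d0 d1] y01 yd.
have H j : exists b : 'I_B.+1, y j < d ^+ b /\ ((b < B)%N -> d ^+ b.+1 <= y j).
  have ex : exists b, (b <= B)%N && (y j < d ^+ b).
    by exists 0; rewrite expr0; case/andP: (y01 j).
  have [|b /andP[bB yb] maxb] := ex_maxnP ex (m := B); first by move=> b /andP[].
  exists (Ordinal (bB : (b < B.+1)%N)); split=> //= bB'.
  rewrite leNgt; apply/negP => yb'; have := maxb b.+1; rewrite bB' yb' ltnn.
  by move/(_ isT).
have [b Hb] := choice H; exists [ffun j => b j]; split; last first.
  by move=> j; rewrite ffunE; case: (Hb j).
under eq_bigr do rewrite ffunE.
have -> : (\sum_j b j + m = \sum_j (b j).+1)%N.
  rewrite -[X in (_ + X)%N]card_ord -sum1_card -big_split /=; apply: eq_bigr => i _.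
  by rewrite addn1.
have [[j bj]|nB] := pselect (exists j, ~ (b j < B)%N).
  rewrite (bigD1 j) //=; move/negP: bj; rewrite -leqNgt => /leqW bj.
  exact: leq_trans bj (leq_addr _ _).
apply/ltnW; rewrite -(ltr_iXn2l d0 d1); apply: le_lt_trans yd.
rewrite -prodrXr; apply: ler_prod => j _; rewrite exprn_ge0 ?(ltW d0) //=.
have [_] := Hb j; apply; apply: contrapT => bj; apply: nB; by exists j.
Qed.

Lemma mult_exponent_le1_negligible (R : realType) (m n : nat) (theta : 'cV[R]_m)
    (nu : {measure set (borel_mx R m n) -> \bar R}) : (0 < m)%N -> (0 < n)%N ->
  strongly_contracting nu ->
  {ae nu, forall X : 'M[R]_(m, n), (mult_exponent X 0 <= 1)%E} ->
  nu.-negligible [set X : 'M[R]_(m, n) | ~ (mult_exponent X theta <= 1)%E].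
Proof.
move=> m0 n0 ctr hom.
pose V (h : nat) := [set X : 'M[R]_(m, n) | approximable
  (fun q : 'cV[int]_n => prod_abs (centred_frac (X *m intvec R q + theta)))
  (@prod_plus R n) (1 + h.+1%:R^-1)].
apply: (@negligibleS _ (borel_mx R m n) _ nu (\bigcup_h V h)).
  by move=> X /approx_gt1[h Vh]; exists h.
apply: negligible_bigcup => h.
                                                                              
                                                                              
                                                                                  
(* Rounding costs m in the exponents of d and n in those of 2^k; differences cost 2m and n more.
   With this L the bounds left are d^(D+2) against (2^k)^D, where D = A + 2n. *)
pose L := (3 * m + 2 * n + 2)%N; pose A := (h.+1 * L)%N; pose B := (A + L)%N.
have L0 : (0 < L)%N by rewrite /L; lia.
have A0 : (0 < A)%N by rewrite muln_gt0.
pose pattern := ({ffun 'I_n -> 'I_A.+2} * {ffun 'I_m -> 'I_B.+1})%type.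
pose admissible (s : pattern) := (\sum_i s.1 i <= A + n)%N && (B <= \sum_j s.2 j + m)%N.
pose P (s : pattern) (k : nat) := [set q : 'cV[int]_n | forall i,
  Num.max 1 `|(q i 0)%:~R : R| < (2 ^+ k) ^+ s.1 i].
pose W (s : pattern) := [set X : 'M[R]_(m, n) | admissible s /\ forall N,
  exists2 k, (N <= k)%N & inhom_near (P s k) theta (fun j => s.2 j) (2^-1 ^+ k) X].
have half01 k : (0 < k)%N -> 0 < (2^-1 ^+ k : R) < 1.
  move=> k0; rewrite exprn_gt0 ?invr_gt0 //= exprn_ilt1 ?lt0n_neq0 //; lra.
apply: (@negligibleS _ (borel_mx R m n) _ nu (\bigcup_s W s)).
  move=> X VX; apply: contrapT => nW.
  have nWs (s : pattern) : exists N, admissible s -> forall k, (N <= k)%N ->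
      ~ inhom_near (P s k) theta (fun j => s.2 j) (2^-1 ^+ k) X.
    have [as_|nas] := boolP (admissible s); last by exists 0%N.
    apply: contrapT => H; apply: nW; exists s => //; split=> // N.
    apply: contrapT => H'; apply: H; exists N => _ k Nk Hk; apply: H'; by exists k.
  have [Ns HNs] := choice nWs.
  (* There are finitely many patterns, so one threshold serves them all. *)
  have [k Nk [q [q0 fq gq]]] := approx_dyadic A0 VX (\max_s Ns s).+1.
  have k0 : (0 < k)%N by exact: leq_ltn_trans (leq0n _) Nk.
  have z1 : (1 : R) < 2 ^+ k by rewrite exprn_egt1 ?ltr1n // lt0n_neq0.
  have [a [sa Ha]] := prod_plus_pattern z1 gq.
  have [|b [sb Hb]] := prod_pattern (half01 _ k0) _ fq.
    by move=> j; rewrite normr_ge0 /=; apply: le_lt_trans (centred_frac_half _ _) _; rewrite invf_lt1 ?ltr1n.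
  have ok : admissible (a, b) by rewrite /admissible /= sa sb.
  apply: (HNs (a, b) ok k); first by apply: ltnW; apply: leq_ltn_trans Nk; exact: leq_bigmax.
  exists q; split=> //.
  exists (\col_j Num.floor ((X *m intvec R q + theta) j 0 + 2^-1)) => j _.
  by apply: le_lt_trans (Hb j); rewrite [centred_frac _ _ _]mxE [X in _ - X%:~R]mxE.
apply: negligible_bigcup_countable => s.
have [/andP[sa sb]|nas] := boolP (admissible s); last first.
  apply: (@negligibleS _ (borel_mx R m n) _ nu _ _ _ (negligible_set0 nu)).
  by move=> X [] /(negP nas).
have b1 : exists j, (1 < s.2 j)%N.
  (* If all [s.2 j] were at most 1, admissibility would give B <= 2m, but L > 2m. *)
  apply: contrapT => H.
  have : (\sum_j s.2 j <= m)%N.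
    rewrite -[X in (_ <= X)%N]card_ord -sum1_card; apply: leq_sum => j _.
    by rewrite leqNgt; apply/negP => Hj; apply: H; exists j.
  move=> /(leq_add (leqnn m)); rewrite addnC => /(leq_trans sb).
  by rewrite /B; generalize A; rewrite /L => c; lia.
apply: (@negligibleS _ (borel_mx R m n) _ nu _ _ _
  (@limsup_inhom_negligible R m n nu setT (P s) (fun j => s.2 j) theta ctr b1 _ _)) => //.
  by move=> X [].
apply: (@negligibleS _ (borel_mx R m n) _ nu _ _ _ hom) => X nX X1; apply: nX.
apply: contrapT => nX.
pose D := (A + 2 * n)%N.
have D0 : (0 < D)%N by rewrite addn_gt0 A0.
apply: (ereal_sup_le1 X1 (w := D.+1%:R / D%:R)).
  by rewrite ltr_pdivlMr ?ltr0n // mul1r ltr_nat.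
split; first by rewrite divr_ge0.
apply: approx_of_dyadic => // N.
have [k Nk [q [q' [p [Pq Pq' qq' Hp]]]]] : exists2 k, (N.+1 <= k)%N &
    hom_near (P s k) (fun j => s.2 j) (2^-1 ^+ k) X.
  apply: contrapT => H; apply: nX; exists N.+1 => k Nk Hk; apply: H.
  by exists k.
have k0 : (0 < k)%N by exact: leq_ltn_trans (leq0n _) Nk.
have z1 : (1 : R) <= 2 ^+ k by rewrite exprn_ege1 ?ler1n.
have z2 : (2 : R) <= 2 ^+ k.
  by rewrite -[leLHS]expr1; apply: ler_weXn2l; rewrite ?ler1n.
have /andP[d0 d1] := half01 k k0.
exists k; first exact: ltnW.
exists (q - q'); split; first by rewrite subr_eq0.
  rewrite addr0; apply: (@le_lt_trans _ _ ((2^-1 ^+ k) ^+ D.+2)); last by rewrite ltr_iXn2l.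
  apply: (@le_trans _ _ (\prod_(j < m) (2^-1 ^+ k) ^+ (s.2 j - 2))).
    apply: ler_prod => j _; rewrite normr_ge0 /=.
    have [bj|bj] := ltnP 1 (s.2 j).
      by apply: le_trans (centred_frac_le _ _ (p j 0)) _; exact/ltW/Hp.
    have -> : (s.2 j - 2 = 0)%N by lia.
    rewrite expr0; apply: le_trans (centred_frac_half _ _) _; rewrite invf_le1 ?ler1n //.
  rewrite prodrXr; apply: ler_wiXn2l; rewrite ?(ltW d0) ?(ltW d1) //.
  have : (\sum_j s.2 j <= \sum_j (s.2 j - 2) + m * 2)%N.
    rewrite -[X in (X * 2)%N]card_ord -sum_nat_const -big_split /=.
    by apply: leq_sum => j _; rewrite addnC -leq_subLR.
  move: sb; move: (\sum_j s.2 j)%N (\sum_j (s.2 j - 2))%N => u v.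
  by rewrite /B /D; generalize A; rewrite /L => c; lia.
apply: (@le_trans _ _ (\prod_(i < n) (2 ^+ k) ^+ (s.1 i).+1)).
  apply: ler_prod => i _; rewrite le_max ler01 /= ge_max exprn_ege1 //=.
  rewrite !mxE rmorphB /=; apply: (le_trans (ler_normB _ _)).
  have := Pq i; have := Pq' i; rewrite !gt_max => /andP[_ h1] /andP[_ h2].
  rewrite exprS; apply: (@le_trans _ _ (2 * (2 ^+ k) ^+ s.1 i)); first lra.
  by apply: ler_wpM2r => //; rewrite !exprn_ge0.
rewrite prodrXr; apply: ler_weXn2l => //.
have -> : (\sum_i (s.1 i).+1 = \sum_i s.1 i + n)%N.
  rewrite -[X in (_ + X)%N]card_ord -sum1_card -big_split /=; apply: eq_bigr => i _.
  by rewrite addn1.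
by rewrite /D mul2n -addnn addnA leq_add2r.
Qed.

Unset Implicit Arguments.

Theorem theorem1 (R : realType) (m n : nat) (hm : (0 < m)%N) (hn : (0 < n)%N)
    (mu : {measure set (borel_mx R m n) -> \bar R}) :
  (contracting_ae mu -> (extremal mu <-> inhomogeneously_extremal mu)) /\
  (strongly_contracting_ae mu ->
    (strongly_extremal mu <-> inhomogeneously_strongly_extremal mu)).
Proof.
split=> ctr; split=> [ext theta|inh]; try exact: inh.
- have ub : mu.-negligible [set X : 'M[R]_(m, n) | ~ (exponent X theta <= 1)%E].
    apply: (negligible_of_local_contracting
      (good := [set X | (exponent X 0 <= 1)%E]) _ ctr).
      by move=> nu nuctr; exact: exponent_le1_negligible.
    apply: (@negligibleS _ (borel_mx R m n) _ mu _ _ _ ext) => X /= + X1.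
    by rewrite X1 lexx.
  apply: (@negligibleS _ (borel_mx R m n) _ mu _ _ _ (negligibleU ext ub)) => X nX.
  have [X1|] := pselect (exponent (X : 'M[R]_(m, n)) 0 = 1%E); last by left.
  right=> Xub; apply: nX; apply/eqP; rewrite eq_le Xub /=.
  by apply: exponent_ge1 => //; rewrite X1.
- have ub : mu.-negligible [set X : 'M[R]_(m, n) | ~ (mult_exponent X theta <= 1)%E].
    apply: (negligible_of_local_contracting
      (good := [set X | (mult_exponent X 0 <= 1)%E]) _ ctr).
      by move=> nu nuctr; exact: mult_exponent_le1_negligible.
    apply: (@negligibleS _ (borel_mx R m n) _ mu _ _ _ ext) => X /= + X1.
    by rewrite X1 lexx.
  apply: (@negligibleS _ (borel_mx R m n) _ mu _ _ _ (negligibleU ext ub)) => X nX.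
  have [X1|] := pselect (mult_exponent (X : 'M[R]_(m, n)) 0 = 1%E); last by left.
  right=> Xub; apply: nX; apply/eqP; rewrite eq_le Xub /=.
  (* The multiplicative exponent at 0 bounds the ordinary one by 1, so the ordinary inhomogeneous
     exponent is at least 1, and the multiplicative one dominates it. *)
  apply: (le_trans _ (exponent_le_mult _ _)); apply: exponent_ge1 => //.
  by apply: (le_trans (exponent_le_mult _ _)); rewrite X1.
Qed.
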